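(* Let $E\to M$ be a vector bundle with connection $\nabla_E$ over a Poisson manifold $(M,w)$. There is an element $R_h^E\in\Omega_h^2(\operatorname{End}(E))$ such that for each $k\ge0$, $(d_h^{\nabla_E})^2$ on $\Omega_h^k(E)$ is given by $(d_h^{\nabla_E})^2\Phi=\Phi\wedge_hR_h^E$, for any $\Phi\in\Omega_h^*(E)$. ($R_h^E$ is called the quantum curvature of $\nabla_E$.)
   Context: In a local frame $\{e_i\}$ of $TM$ with dual frame $\{e^i\}$, $w^{ij}=w(e^i,e^j)$ (antisymmetric), repeated indices summed. For a vector $v$ and a form $\alpha$, $v\vdash\alpha$ is contraction of $v$ into the first slot and $\alpha\dashv v$ contraction into the last slot. The quantum exterior product on $\Omega_h^*(M)=\Omega(M)[h]$ is the $\mathbb{R}[h]$-bilinear product $$\alpha\wedge_h\beta=\sum_{n\ge0}\frac{h^n}{n!}w^{i_1j_1}\cdots w^{i_nj_n}(\alpha\dashv e_{i_1}\dashv\cdots\dashv e_{i_n})\wedge(e_{j_n}\vdash\cdots\vdash e_{j_1}\vdash\beta)$$ (contractions on $\alpha$ by $e_{i_1}$ first, on $\beta$ by $e_{j_1}$ first). $d_h=d-h\delta$, where $\delta\alpha=w\vdash(d\alpha)-d(w\vdash\alpha)$, $w\vdash\beta=\frac12w^{kl}\,e_k\vdash(e_l\vdash\beta)$. $h$ has degree $2$. $\Omega_h^*(E)=\Omega^*(E)[h]$ is the space of $E$-valued forms with coefficients in polynomials in $h$, graded with $h$ of degree $2$; similarly $\Omega_h^*(\operatorname{End}(E))$. The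 quantum covariant derivative $d_h^{\nabla_E}:\Omega_h^*(E)\to\Omega_h^*(E)$ is defined locally as follows: if $\mathbf{s}=(\mathbf{s}_j)$ is a local frame of $E$ with connection $1$-form $\theta$, $\nabla_E\mathbf{s}_j=\sum_k\mathbf{s}_k\otimes\theta_j^k$, and $\Phi=\mathbf{s}\otimes\phi=\sum_k\mathbf{s}_k\otimes\phi^k$, then $d_h^{\nabla_E}\Phi=\mathbf{s}\otimes(\theta\wedge_h\phi+d_h\phi)=\sum_k\mathbf{s}_k\otimes(\sum_j\theta_j^k\wedge_h\phi^j+d_h\phi^k)$; this is independent of the frame. For $R\in\Omega_h^*(\operatorname{End}(E))$ represented in the frame $\mathbf{s}$ by a matrix $\Theta=(\Theta_j^k)$ of forms, $\Phi\wedge_hR$ is the $E$-valued form $\mathbf{s}\otimes(\Theta\wedge_h\phi)=\sum_k\mathbf{s}_k\otimes\sum_j\Theta_j^k\wedge_h\phi^j$. *)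

(* Defs.v *)
From HB Require Import structures.
From mathcomp Require Import all_boot all_order all_algebra.
From mathcomp Require Import all_classical all_reals all_analysis.

Set Implicit Arguments.
Unset Strict Implicit.
Unset Printing Implicit Defensive.

Import Order.TTheory GRing.Theory Num.Theory numFieldNormedType.Exports.

Local Open Scope ring_scope.

(******************************************************************************)
(* Linear algebra: the exterior algebra of the dual of R^m.                   *)
(* [ext m W] is W (x) Lambda(R^m)^*: [a K] is the coefficient of              *)
(* dx^K = dx^k1 /\ ... /\ dx^kn, where K = {k1 < ... < kn}.                   *)
(******************************************************************************)

Notation ext m W := {ffun {set 'I_m} -> W}.

Definition ext1 (R : realType) (m : nat) : ext m R :=
  [ffun K : {set 'I_m} => (K == finset.set0)%:R].

Definition edx (R : realType) (m : nat) (k : 'I_m) : ext m R :=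
  [ffun K : {set 'I_m} => (K == [set k]%SET)%:R].

(* a (x) v *)
Definition etens (R : realType) (m : nat) (W : lmodType R)
  (a : ext m R) (v : W) : ext m W := [ffun K : {set 'I_m} => a K *: v].

(* dx^I /\ dx^J = (-1)^(inversions I J) dx^(I u J) when I and J are disjoint. *)
Definition inversions (m : nat) (I J : {set 'I_m}) : nat :=
  #|[set ij : 'I_m * 'I_m | [&& ij.1 \in I, ij.2 \in J & (ij.2 < ij.1)%N]]%SET|.

Definition wedge (R : realType) (m : nat) (a b : ext m R) : ext m R :=
  [ffun K : {set 'I_m} => \sum_(I : {set 'I_m} | I \subset K)
     (-1) ^+ inversions I (K :\: I) * a I * b (K :\: I)].

(* e_i |- a : contraction of e_i into the first slot *)
Definition lcontr (R : realType) (m : nat) (i : 'I_m) (a : ext m R) : ext m R :=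
  [ffun K : {set 'I_m} => if i \in K then 0
             else (-1) ^+ #|[set k in K | (k < i)%N]%SET| * a (i |: K)].

(* a -| e_i : contraction of e_i into the last slot *)
Definition rcontr (R : realType) (m : nat) (a : ext m R) (i : 'I_m) : ext m R :=
  [ffun K : {set 'I_m} => if i \in K then 0
             else (-1) ^+ #|[set k in K | (i < k)%N]%SET| * a (i |: K)].

(* w |- a = 1/2 w^{kl} e_k |- (e_l |- a) *)
Definition bicontr (R : realType) (m : nat) (w : 'M[R]_m) (a : ext m R) :
  ext m R := 2^-1 *: \sum_k \sum_l w k l *: lcontr k (lcontr l a).

(* The algebra morphism with dx^i |-> \sum_k A k i dx^k. *)
Definition epull (R : realType) (m : nat) (A : 'M[R]_m) (a : ext m R) :
  ext m R :=
  \sum_(I : {set 'I_m})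
    a I *: \big[@wedge R m/ext1 R m]_(i <- enum I) \sum_k A k i *: edx R k.

(* w^{i1 j1} ... w^{in jn} (a -| e_i1 -| ... -| e_in)
                           /\ (e_jn |- ... |- e_j1 |- b) *)
Definition qterm (R : realType) (m : nat) (w : 'M[R]_m) (n : nat)
  (a b : ext m R) : ext m R :=
  \sum_(i : n.-tuple 'I_m) \sum_(j : n.-tuple 'I_m)
    (\prod_(l < n) w (tnth i l) (tnth j l)) *:
      wedge (foldl (@rcontr R m) a i) (foldl (fun b' k => lcontr k b') b j).

(* Polynomials in h are given by their sequences of coefficients: [a n] is    *)
(* the coefficient of h^n.  Since the product is R[h]-bilinear, the           *)
(* coefficient of h^N in a /\_h b collects the terms h^n/n! h^p h^q with      *)
(* n + p + q = N.                                                             *)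
Definition qwedge (R : realType) (m : nat) (w : 'M[R]_m)
  (a b : nat -> ext m R) (N : nat) : ext m R :=
  \sum_(n < N.+1) \sum_(p < N.+1) \sum_(q < N.+1 | (n + p + q == N)%N)
    (n`!%:R)^-1 *: qterm w n (a p) (b q).

Definition hconst (R : realType) (m : nat) (a : ext m R) (n : nat) : ext m R :=
  if n is 0%N then a else 0.

(******************************************************************************)
(* Smooth manifolds                                                           *)
(******************************************************************************)

Definition basisv (R : realType) (m : nat) (k : 'I_m) : 'rV[R]_m :=
  delta_mx 0 k.

Definition iter_partial (R : realType) (m : nat) (s : seq 'I_m)
  (f : 'rV[R]_m -> R) : 'rV[R]_m -> R :=
  foldr (fun k g x => 'D_(basisv R k) g x) f s.

(* C^oo on O (meant for O open): all iterated partial derivatives exist and   *)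
(* are continuous on O.                                                       *)
Definition cinfty (R : realType) (m : nat) (O : set 'rV[R]_m)
  (f : 'rV[R]_m -> R) : Prop :=
  forall (s : seq 'I_m) (x : 'rV[R]_m), O x ->
    {for x, continuous (iter_partial s f)} /\
    forall k : 'I_m, derivable (iter_partial s f) x (basisv R k).

(* A Hausdorff second countable space with a smooth atlas.  [chart c] is      *)
(* meaningful on [cdom c] and [cinv c] on its image.                          *)
Record smoothManifold (R : realType) (m : nat) := SmoothManifold {
  mspace :> topologicalType;
  mhausdorff : hausdorff_space mspace;
  msecond_countable : @second_countable mspace;
  cindex : Type;
  cdom : cindex -> set mspace;
  chart : cindex -> mspace -> 'rV[R]_m;
  cinv : cindex -> 'rV[R]_m -> mspace;
  cdom_open : forall c, open (cdom c);
  cdom_cover : forall p, exists c, cdom c p;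
  chart_open : forall c, open (chart c @` cdom c)%classic;
  chartK : forall c p, cdom c p -> cinv c (chart c p) = p;
  chart_continuous : forall c p, cdom c p -> {for p, continuous (chart c)};
  cinv_continuous : forall c p, cdom c p ->
    {for chart c p, continuous (cinv c)};
  transition_smooth : forall c c' l,
    cinfty (chart c @` (cdom c `&` cdom c'))%classic
           (fun x => chart c' (cinv c x) 0 l)
}.

(* f is C^oo on U (meant for U open) *)
Definition smooth_on (R : realType) (m : nat) (M : smoothManifold R m)
  (U : set M) (f : M -> R) : Prop :=
  forall c : cindex M,
    cinfty (chart c @` (U `&` cdom c))%classic (f \o @cinv _ _ M c).

(* the derivative of f at p along the k-th coordinate of the chart c *)
Definition cpartial (R : realType) (m : nat) (M : smoothManifold R m)
  (c : cindex M) (k : 'I_m) (f : M -> R) (p : M) : R :=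
  'D_(basisv R k) (f \o @cinv _ _ M c) (chart c p).

(* jacobian c c' p k l = d x_c'^l / d x_c^k *)
Definition jacobian (R : realType) (m : nat) (M : smoothManifold R m)
  (c c' : cindex M) (p : M) : 'M[R]_m :=
  \matrix_(k, l) cpartial c k (fun q => chart c' q 0 l) p.

(******************************************************************************)
(* Differential forms                                                         *)
(* A W-valued form is given by its components [a c p] at p in the coordinate  *)
(* coframe of the chart c, relevant only for p in [cdom c].                   *)
(******************************************************************************)

Definition vform (R : realType) (m : nat) (M : smoothManifold R m)
  (W : M -> Type) := cindex M -> forall p : M, ext m (W p).

Definition is_form_on (R : realType) (m : nat) (M : smoothManifold R m)
  (U : set M) (a : vform (fun _ : M => R)) : Prop :=
  (forall c K, smooth_on (U `&` cdom c)%classic (fun p => a c p K)) /\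
  (forall c c' p, U p -> cdom c p -> cdom c' p ->
     a c p = epull (jacobian c c' p) (a c' p)).

(* the exterior derivative \sum_k dx^k /\ d_k a, computed in the chart c *)
Definition ext_d (R : realType) (m : nat) (M : smoothManifold R m)
  (c : cindex M) (a : M -> ext m R) (p : M) : ext m R :=
  \sum_k wedge (edx R k) [ffun K : {set 'I_m} => cpartial c k (fun q => a q K) p].

Definition fun_d (R : realType) (m : nat) (M : smoothManifold R m)
  (c : cindex M) (f : M -> R) : M -> ext m R :=
  ext_d c (fun q => f q *: ext1 R m).

(******************************************************************************)
(* Poisson structures; [bivec c p i j] is w(dx^i, dx^j) at p in the chart c.  *)
(******************************************************************************)

Definition pbracket (R : realType) (m : nat) (M : smoothManifold R m)
  (c : cindex M) (w : M -> 'M[R]_m) (f g : M -> R) (p : M) : R :=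
  \sum_i \sum_j w p i j * cpartial c i f p * cpartial c j g p.

Record poissonStructure (R : realType) (m : nat) (M : smoothManifold R m) :=
  PoissonStructure {
  bivec :> cindex M -> M -> 'M[R]_m;
  bivec_antisym : forall c p, cdom c p -> (bivec c p)^T = - bivec c p;
  bivec_smooth : forall c i j, smooth_on (cdom c) (fun p => bivec c p i j);
  bivec_compat : forall c c' p, cdom c p -> cdom c' p ->
    bivec c' p = (jacobian c c' p)^T *m bivec c p *m jacobian c c' p;
  bivec_jacobi : forall (c : cindex M) (U : set M) (f g h : M -> R),
    open U -> (U `<=` cdom c)%classic ->
    smooth_on U f -> smooth_on U g -> smooth_on U h ->
    let br := pbracket c (bivec c) in
    forall p, U p -> br f (br g h) p + br g (br h f) p + br h (br f g) p = 0
}.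

(* delta a = w |- da - d(w |- a), computed in the chart c *)
Definition koszul (R : realType) (m : nat) (M : smoothManifold R m)
  (w : poissonStructure M) (c : cindex M) (a : M -> ext m R) (p : M) :
  ext m R :=
  bicontr (w c p) (ext_d c a p) - ext_d c (fun q => bicontr (w c q) (a q)) p.

(* d_h = d - h delta, computed in the chart c *)
Definition qd (R : realType) (m : nat) (M : smoothManifold R m)
  (w : poissonStructure M) (c : cindex M) (a : nat -> M -> ext m R)
  (n : nat) (p : M) : ext m R :=
  ext_d c (a n) p - (if n is n'.+1 then koszul w c (a n') p else 0).

(******************************************************************************)
(* Vector bundles and connections                                             *)
(******************************************************************************)

(* Real vector bundle of rank r: a family of fibres with an atlas of local    *)
(* frames related by smooth changes of frames; [triv_at p] is the index of a  *)
(* frame defined around p.                                                    *)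
Record vectorBundle (R : realType) (m : nat) (M : smoothManifold R m)
  (r : nat) := VectorBundle {
  fibre :> M -> vectType R;
  tindex : Type;
  tdom : tindex -> set M;
  frame : tindex -> forall p : M, r.-tuple (fibre p);
  triv_at : M -> tindex;
  tdom_open : forall t, open (tdom t);
  triv_atP : forall p, tdom (triv_at p) p;
  frame_basis : forall t p, tdom t p -> basis_of fullv (frame t p);
  frame_smooth : forall t t' j k,
    smooth_on (tdom t `&` tdom t')%classic
      (fun p => coord (frame t' p) k (tnth (frame t p) j))
}.

(* k-th component of an E-valued form in the frame X of the fibre *)
Definition ecomp (R : realType) (m r : nat) (V : vectType R)
  (X : r.-tuple V) (k : 'I_r) (a : ext m V) : ext m R :=
  [ffun K : {set 'I_m} => coord X k (a K)].

(* the entry Theta_j^k of the matrix representing an End(E)-valued form:      *)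
(* T s_j = \sum_k s_k (x) Theta_j^k                                           *)
Definition endcomp (R : realType) (m r : nat) (V : vectType R)
  (X : r.-tuple V) (j k : 'I_r) (T : ext m 'End(V)) : ext m R :=
  [ffun K : {set 'I_m} => coord X k (T K (tnth X j))].

Definition smooth_section_on (R : realType) (m r : nat)
  (M : smoothManifold R m) (E : vectorBundle M r) (U : set M)
  (s : forall p : M, E p) : Prop :=
  forall (t : tindex E) k,
    smooth_on (U `&` tdom t)%classic (fun p => coord (frame t p) k (s p)).

Definition is_eform_on (R : realType) (m r : nat) (M : smoothManifold R m)
  (E : vectorBundle M r) (U : set M) (Phi : vform (fun p => E p)) : Prop :=
  forall (t : tindex E) k,
    is_form_on (U `&` tdom t)%classic
      (fun c p => ecomp (frame t p) k (Phi c p)).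

Definition is_endform_on (R : realType) (m r : nat) (M : smoothManifold R m)
  (E : vectorBundle M r) (U : set M) (T : vform (fun p => 'End(E p))) : Prop :=
  forall (t : tindex E) j k,
    is_form_on (U `&` tdom t)%classic
      (fun c p => endcomp (frame t p) j k (T c p)).

(* A connection as an operator on local sections.  [nabla s] is meaningful    *)
(* wherever s is smooth; [nabla_local] says that its values over an open set  *)
(* only depend on the restriction of s to that set.                           *)
Record connection (R : realType) (m r : nat) (M : smoothManifold R m)
  (E : vectorBundle M r) := Connection {
  nabla :> (forall p : M, E p) -> vform (fun p => E p);
  nabla_form : forall (U : set M) s, open U -> smooth_section_on U s ->
    is_eform_on U (nabla s) /\
    forall c p K, U p -> cdom c p -> nabla s c p K != 0 -> #|K| = 1%N;
  nabla_local : forall (U : set M) s s', open U ->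
    smooth_section_on U s -> smooth_section_on U s' ->
    (forall p, U p -> s p = s' p) ->
    forall c p, U p -> cdom c p -> nabla s c p = nabla s' c p;
  nabla_add : forall (U : set M) s s', open U ->
    smooth_section_on U s -> smooth_section_on U s' ->
    forall c p, U p -> cdom c p ->
      nabla (fun q => s q + s' q) c p = nabla s c p + nabla s' c p;
  nabla_leibniz : forall (U : set M) (f : M -> R) s, open U ->
    smooth_on U f -> smooth_section_on U s ->
    forall c p, U p -> cdom c p ->
      nabla (fun q => f q *: s q) c p =
        f p *: nabla s c p + etens (fun_d c f p) (s p)
}.

(* theta_j^k, where nabla s_j = \sum_k s_k (x) theta_j^k, for the frame s of  *)
(* index t *)
Definition conn_form (R : realType) (m r : nat) (M : smoothManifold R m)
  (E : vectorBundle M r) (D : connection E) (t : tindex E) (j k : 'I_r)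
  (c : cindex M) (p : M) : ext m R :=
  ecomp (frame t p) k (D (fun q => tnth (frame t q) j) c p).

(******************************************************************************)
(* Forms with coefficients in polynomials in h                                *)
(******************************************************************************)

(* [Phi n] is the coefficient of h^n *)
Definition hform (R : realType) (m : nat) (M : smoothManifold R m)
  (W : M -> Type) := nat -> vform W.

Definition heq (R : realType) (m : nat) (M : smoothManifold R m)
  (W : M -> Type) (Phi Psi : hform W) : Prop :=
  forall n c p, cdom c p -> Phi n c p = Psi n c p.

Definition hpoly (R : realType) (m : nat) (M : smoothManifold R m)
  (W : M -> vectType R) (Phi : hform (fun p => W p)) : Prop :=
  exists N, forall n c p, (N <= n)%N -> cdom c p -> Phi n c p = 0.

(* homogeneous of total degree d, h having degree 2 *)
Definition hdegree (R : realType) (m : nat) (M : smoothManifold R m)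
  (W : M -> vectType R) (d : nat) (Phi : hform (fun p => W p)) : Prop :=
  forall n c p K, cdom c p -> Phi n c p K != 0 -> (#|K| + n.*2)%N = d.

(* Omega_h^*(E) *)
Definition is_hEform (R : realType) (m r : nat) (M : smoothManifold R m)
  (E : vectorBundle M r) (Phi : hform (fun p => E p)) : Prop :=
  (forall n, is_eform_on setT (Phi n)) /\ hpoly Phi.

(* Omega_h^*(End E) *)
Definition is_hEndform (R : realType) (m r : nat) (M : smoothManifold R m)
  (E : vectorBundle M r) (T : hform (fun p => 'End(E p))) : Prop :=
  (forall n, is_endform_on setT (T n)) /\
  @hpoly R m M (fun p => 'End(E p) : vectType R) T.

(* s (x) (theta /\_h phi + d_h phi) in the frame s of index t, where          *)
(* Phi = s (x) phi *)
Definition qcovd_in (R : realType) (m r : nat) (M : smoothManifold R m)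
  (w : poissonStructure M) (E : vectorBundle M r) (D : connection E)
  (t : tindex E) (Phi : hform (fun p => E p)) : hform (fun p => E p) :=
  fun n c p =>
    let phi k n q := ecomp (frame t q) k (Phi n c q) in
    \sum_k etens
      (\sum_j qwedge (w c p) (hconst (conn_form D t j k c p))
                             (fun i => phi j i p) n
       + qd w c (phi k) n p)
      (tnth (frame t p) k).

(* The quantum covariant derivative: its value at p is computed in the chosen *)
(* frame around p; as the local formula is independent of the frame, so is    *)
(* the result.                                                                *)
Definition qcovd (R : realType) (m r : nat) (M : smoothManifold R m)
  (w : poissonStructure M) (E : vectorBundle M r) (D : connection E)
  (Phi : hform (fun p => E p)) : hform (fun p => E p) :=
  fun n c p => qcovd_in w D (triv_at E p) Phi n c p.

(* Phi /\_h T = \sum_k s_k (x) \sum_j Theta_j^k /\_h phi^j; this is pointwise *)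
(* independent of the frame s.                                                *)
Definition qwedge_end (R : realType) (m r : nat) (M : smoothManifold R m)
  (w : poissonStructure M) (E : vectorBundle M r)
  (Phi : hform (fun p => E p)) (T : hform (fun p => 'End(E p))) :
  hform (fun p => E p) :=
  fun n c p =>
    let s := frame (triv_at E p) p in
    \sum_k etens
      (\sum_j qwedge (w c p) (fun i => endcomp s j k (T i c p))
                             (fun i => ecomp s j (Phi i c p)) n)
      (tnth s k).

(* Main.v *)
Require Import Defs.
From HB Require Import structures.
From mathcomp Require Import all_boot all_order all_algebra.
From mathcomp Require Import all_classical all_reals all_analysis.
From mathcomp Require Import ring lra.

Set Implicit Arguments.
Unset Strict Implicit.
Unset Printing Implicit Defensive.

Import Order.TTheory GRing.Theory Num.Theory numFieldNormedType.Exports.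

Local Open Scope ring_scope.

(** The idea is to conjugate by the contraction with the bivector.  Write [i] for
    [w |- _] and [D] for the ordinary covariant derivative on vectors of forms,
    in a chart and a frame.  For a 1-form [theta], the quantum product by [theta]
    is [theta - h [i, theta]] as an operator ([qwedge_one_form]), and [d_h] is
    [d - h [i, d]] by definition.  Hence the quantum covariant derivative is
    [D - h [i, D]], and its square is

      [D^2 - h [i, D^2] + h^2 [i, D]^2].

    The operator [i] commutes with [[i, D]]: for the part of order zero because
    contractions anticommute with each other, and for the exterior derivative
    because of the Jacobi identity ([iota_koszulE]).  Therefore
    [[i, D]^2 = 1/2 [i, [i, D^2]]] ([quantum_square]).  Since [D^2] is the product
    with the curvature 2-form [F] ([Dcov_Dcov]), the square of the quantum
    covariant derivative is the conjugate of [F] by [exp (- h i)], and this is the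
    quantum product by [F - h (w |- F)] ([qwedge_qcurv]): the three terms of the
    quantum product with a 2-form are [F] and its first two commutators with [i],
    up to the scalar [w |- F] that is corrected by the term of order [h].  So the
    quantum curvature is [F - h (w |- F)], of total degree 2.

    To pass to the manifold, one needs that the local formula does not depend on
    the frame ([qcovd_in_frame]), so that near a point the quantum covariant
    derivative is computed in one frame even when it is iterated, that [F] is
    tensorial under changes of frame ([curv_gauge]) and that it transforms as a
    form under changes of chart ([curvature_form_pull]).  These rest on the
    calculus of smooth functions of the first part: the chain rule, the stability
    of smoothness under composition, and the symmetry of second derivatives. *)

(** * Smooth functions on open subsets of R^m *)

Section Calculus.
Local Open Scope classical_set_scope.
Variable R : realType.

Lemma continuous_add (T : topologicalType) (f g : T -> R) (x : T) :
  {for x, continuous f} -> {for x, continuous g} ->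
  {for x, continuous (fun y => f y + g y)}.
Proof. exact: continuousD. Qed.

Lemma continuous_mul (T : topologicalType) (f g : T -> R) (x : T) :
  {for x, continuous f} -> {for x, continuous g} ->
  {for x, continuous (fun y => f y * g y)}.
Proof. exact: continuousM. Qed.

Lemma row_norm_le m (u : 'rV[R]_m) (c : R) : 0 <= c ->
  (forall k, `|u 0 k| <= c) -> `|u| <= c.
Proof.
move=> c0 H; rewrite [leLHS]/Num.Def.normr/= mx_normrE.
by apply: bigmax_le => // -[i j] _ /=; rewrite ord1.
Qed.

Lemma coord_norm_le m (u : 'rV[R]_m) k : `|u 0 k| <= `|u|.
Proof.
rewrite [leRHS]/Num.Def.normr/= mx_normrE.
exact: (le_bigmax _ (fun ij => `|u ij.1 ij.2|) (0, k)).
Qed.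

Lemma basisv_norm m k : `|basisv R k : 'rV[R]_m| <= 1.
Proof.
by apply: row_norm_le => // j; rewrite mxE eqxx /=; case: eqP; rewrite ?normr1 ?normr0.
Qed.

(** Bounding [t] in absolute value, instead of placing it between [0] and [s],
    covers both signs of [s]. *)
Lemma MVT_line m (f : 'rV[R]_m -> R) (y v : 'rV[R]_m) (s : R) :
  (forall t, `|t| <= `|s| -> derivable f (t *: v + y) v) ->
  exists2 t, `|t| <= `|s| & f (s *: v + y) - f y = s * 'D_v f (t *: v + y).
Proof.
move=> df; pose phi (t : R) := f (t *: v + y).
have dphi t : `|t| <= `|s| -> is_derive t (1 : R) phi ('D_v f (t *: v + y)).
  move=> ts.
  have E : (fun h : R => h^-1 *: ((phi \o shift t) (h *: (1 : R)) - phi t)) =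
           (fun h : R => h^-1 *: ((f \o shift (t *: v + y)) (h *: v) - f (t *: v + y))).
    apply/funext => h; congr (_ *: (_ - _)); rewrite /phi /=; congr f.
    by rewrite (mulr1 h : h *: 1 = h) scalerDl addrA.
  apply: DeriveDef; first by rewrite /derivable E; exact: df.
  by rewrite /derive E.
have dc a b : (forall t, t \in `[a, b]%R -> `|t| <= `|s|) -> {within `[a, b], continuous phi}.
  move=> H; apply: derivable_within_continuous => t tab.
  by have [] := dphi t (H t tab).
have [s0|s0|s0] := ltgtP s 0.
- have sub t : t \in `[s, 0]%R -> `|t| <= `|s|.
    by rewrite in_itv /= => /andP[st t0]; rewrite !ler0_norm ?lerN2// ltW.
  have [|||t ts E] := @MVT R phi (fun t => 'D_v f (t *: v + y)) s 0.
  + exact: s0.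
  + by move=> t ts; apply: dphi; apply: sub; exact: subset_itv_oo_cc ts.
  + exact: dc.
  exists t; first by apply: sub; exact: subset_itv_oo_cc ts.
  move: E; rewrite /phi scale0r !add0r => /(congr1 -%R); rewrite opprB => ->.
  by rewrite mulrN opprK mulrC.
- have sub t : t \in `[0, s]%R -> `|t| <= `|s|.
    by rewrite in_itv /= => /andP[t0 ts]; rewrite !ger0_norm// ltW.
  have [|||t ts E] := @MVT R phi (fun t => 'D_v f (t *: v + y)) 0 s.
  + exact: s0.
  + by move=> t ts; apply: dphi; apply: sub; exact: subset_itv_oo_cc ts.
  + exact: dc.
  exists t; first by apply: sub; exact: subset_itv_oo_cc ts.
  by move: E; rewrite /phi scale0r !add0r => ->; rewrite subr0 mulrC.
- by exists 0; rewrite ?normr0// s0 scale0r add0r subrr mul0r.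
Qed.

Definition dual_form m (a : 'I_m -> R) (h : 'rV[R]_m) : R := \sum_k h 0 k * a k.
Lemma dual_form_is_linear m (a : 'I_m -> R) : linear (dual_form a : 'rV[R]_m -> R).
Proof.
move=> c u v; rewrite /dual_form scaler_sumr -big_split; apply: eq_bigr => k _.
by rewrite !mxE /GRing.scale /=; ring.
Qed.
HB.instance Definition _ m (a : 'I_m -> R) :=
  GRing.isLinear.Build R 'rV[R]_m R _ (dual_form a) (dual_form_is_linear a).

Lemma dual_form_continuous m (a : 'I_m -> R) : continuous (dual_form a).
Proof.
move=> x; rewrite /dual_form.
suff H r : {for x, continuous (fun h : 'rV[R]_m => \sum_(k <- r) h 0 k * a k)} by exact: H.
elim: r => [|k r IH].
  rewrite (_ : (fun h => _) = cst 0); first exact: cst_continuous.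
  by apply/funext => h; rewrite big_nil.
rewrite (_ : (fun h => _) = (fun h : 'rV[R]_m => h 0 k * a k + \sum_(j <- r) h 0 j * a j)).
  apply: continuous_add; last exact: IH.
  by apply: continuous_mul; [exact: coord_continuous|exact: cst_continuous].
by apply/funext => h; rewrite big_cons.
Qed.

(** Moving from [x] to [h + x] one coordinate at a time, the mean value theorem
    estimates each of the [m] increments of [f]. *)
Lemma C1_differentiable m (O : set 'rV[R]_m) (f : 'rV[R]_m -> R) x :
  open O -> O x -> (forall y k, O y -> derivable f y (basisv R k)) ->
  (forall k, {for x, continuous (fun y => 'D_(basisv R k) f y)}) ->
  differentiable f x.
Proof.
move=> oO Ox df cf.
pose a k := 'D_(basisv R k) f x.
pose tr (h : 'rV[R]_m) j : 'rV[R]_m := \row_k (if (k < j)%N then h 0 k else 0).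
have E : f \o shift x = cst (f x) + dual_form a +o_ (0 : 'rV[R]_m) id.
  apply/eqaddoP => e e0.
  have e'0 : 0 < e / m.+1%:R by rewrite divr_gt0.
  have : \forall y \near x, O y /\ forall k, `|a k - 'D_(basisv R k) f y| <= e / m.+1%:R.
    near=> y; split; first by near: y; exact: open_nbhs_nbhs.
    move=> k; move: k; near: y; apply: filter_forall => k.
    by have /cvgrPdist_le := cf k; apply.
  move=> /nbhs_ballP[d /= d0 Hd].
  near=> h.
  have hd : `|h| < d by near: h; apply: (@pseudometric_normed_Zmodule.nbhs0_lt R 'rV[R]_m).
  have step (j : 'I_m) (t : R) : `|t| <= `|h 0 j| ->
      O (t *: basisv R j + (tr h j + x)) /\
      forall k, `|a k - 'D_(basisv R k) f (t *: basisv R j + (tr h j + x))| <= e / m.+1%:R.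
    move=> th; apply: Hd; rewrite -ball_normE /= addrA opprD addrCA subrr addr0 normrN.
    apply: le_lt_trans hd; apply: row_norm_le => // k.
    rewrite !mxE eqxx /=; have [->|kj] := eqVneq k j.
      by rewrite ltnn addr0 mulr1 (le_trans th)// coord_norm_le.
    by rewrite mulr0 add0r; case: ifP => _; rewrite ?normr0// coord_norm_le.
  have tr0 : tr h 0 = 0 by apply/rowP => k; rewrite !mxE.
  have trm : tr h m = h by apply/rowP => k; rewrite !mxE ltn_ord.
  have trS (j : 'I_m) : tr h j.+1 = h 0 j *: basisv R j + tr h j.
    apply/rowP => k; rewrite !mxE eqxx /= ltnS leq_eqVlt.
    have [kj|kj] := eqVneq k j; first by rewrite kj eqxx ltnn mulr1 addr0.
    by rewrite (_ : (val k == val j) = false) ?mulr0 ?add0r//; exact/negbTE.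
  have tel : f (h + x) - f x = \sum_(j < m) (f (tr h j.+1 + x) - f (tr h j + x)).
    rewrite -(big_mkord xpredT (fun j => f (tr h j.+1 + x) - f (tr h j + x))).
    by rewrite telescope_sumr// trm tr0 add0r.
  rewrite /= !fctE /= opprD addrA tel /dual_form -sumrB.
  apply: (@le_trans _ _ (\sum_(j < m) (e / m.+1%:R) * `|h|)).
    apply: le_trans (ler_norm_sum _ _ _) _; apply: ler_sum => j _.
    rewrite trS -(addrA (h 0 j *: _)).
    have [|t th ->] := @MVT_line m f (tr h j + x) (basisv R j) (h 0 j).
      by move=> t /step[Ot _]; exact: df.
    rewrite -mulrBr normrM mulrC ler_pM// ?coord_norm_le//.
    by rewrite distrC; have [_ ] := step _ _ th; apply.
  rewrite (_ : \sum_(_ < m) _ = e * `|h| * (m%:R / m.+1%:R)); last first.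
    by rewrite sumr_const card_ord -mulr_natr; ring.
  rewrite ler_piMr ?mulr_ge0//; first exact: ltW.
  by rewrite ler_pdivrMr// mul1r ler_nat.
have D : 'd f x = dual_form a :> (_ -> _).
  by apply: diff_unique => //; exact: dual_form_continuous.
apply/diff_locallyP; rewrite D; split => //; exact: dual_form_continuous.
Unshelve. all: by end_near. Qed.


Lemma cinftyS m O (f : 'rV[R]_m -> R) k : cinfty O f ->
  cinfty O (fun x => 'D_(basisv R k) f x).
Proof.
move=> cf s; have := cf (rcons s k); rewrite /iter_partial foldr_rcons.
by move=> H x /H.
Qed.

(** Smoothness is coinductive: a class of functions which are continuous with
    partial derivatives, and whose partial derivatives are again in the class,
    consists of smooth functions. *)
Lemma cinfty_coind m (O : set 'rV[R]_m) (S : ('rV[R]_m -> R) -> Prop) : open O ->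
  (forall f, S f ->
     (forall x, O x -> {for x, continuous f} /\
                       forall k, derivable f x (basisv R k)) /\
     forall k, exists2 g, S g & forall x, O x -> 'D_(basisv R k) f x = g x) ->
  forall f, S f -> cinfty O f.
Proof.
move=> oO H f Sf s.
have : exists2 g, S g & forall x, O x -> f x = g x by exists f.
elim/last_ind: s f {Sf} => [|s k IH] f [g Sg fg].
  move=> x Ox; have [/(_ x Ox)[cg dg] _] := H g Sg.
  have gf : {near x, g =1 f}.
    by near=> y; apply/esym/fg; near: y; exact: open_nbhs_nbhs.
  split=> [|k] /=; last exact: near_eq_derivable gf (dg k).
  rewrite /prop_for /continuous_at fg//; apply: cvg_trans cg.
  exact: near_eq_cvg gf.
rewrite /iter_partial foldr_rcons; apply: IH.
have [_ /(_ k)[g' Sg' gg']] := H g Sg; exists g' => // x Ox; rewrite -gg'//.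
apply: near_eq_derive; near=> y; apply: fg; near: y; exact: open_nbhs_nbhs.
Unshelve. all: by end_near. Qed.

(** The algebra generated by [G]. Smoothness is proved up to this closure, so that
    sums, products and the chain rule need no separate coinductions. *)
Inductive fun_alg m (G : ('rV[R]_m -> R) -> Prop) : ('rV[R]_m -> R) -> Prop :=
| fun_alg_gen f : G f -> fun_alg G f
| fun_alg_cst c : fun_alg G (fun=> c)
| fun_alg_add f g : fun_alg G f -> fun_alg G g -> fun_alg G (fun x => f x + g x)
| fun_alg_mul f g : fun_alg G f -> fun_alg G g -> fun_alg G (fun x => f x * g x).

(** By the sum and product rules it is enough that the partial derivatives of the
    generators lie in the algebra they generate. *)
Lemma cinfty_alg m (O : set 'rV[R]_m) (G : ('rV[R]_m -> R) -> Prop) : open O ->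
  (forall f, G f ->
     (forall x, O x -> {for x, continuous f} /\
                       forall k, derivable f x (basisv R k)) /\
     forall k, exists2 g, fun_alg G g & forall x, O x -> 'D_(basisv R k) f x = g x) ->
  forall f, fun_alg G f -> cinfty O f.
Proof.
move=> oO H; apply: cinfty_coind => // f; elim=> {f} [f Gf|c|f g Sf [cf df] Sg [cg dg]|f g Sf [cf df] Sg [cg dg]].
- exact: H.
- split=> [x Ox|k]; first by split; [exact: cst_continuous|move=> k; exact: derivable_cst].
  by exists (fun=> 0) => [|x _]; [exact: fun_alg_cst|exact: derive_cst].
- split=> [x Ox|k].
    have [cfx dfx] := cf x Ox; have [cgx dgx] := cg x Ox.
    by split=> [|k]; [exact: continuous_add|exact: derivableD].
  have [f' Sf' ff'] := df k; have [g' Sg' gg'] := dg k.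
  exists (fun x => f' x + g' x) => [|x Ox]; first exact: fun_alg_add.
  have [_ dfx] := cf x Ox; have [_ dgx] := cg x Ox.
  by rewrite (@deriveD R _ _ f g)// ff'// gg'.
- split=> [x Ox|k].
    have [cfx dfx] := cf x Ox; have [cgx dgx] := cg x Ox.
    by split=> [|k]; [exact: continuous_mul|exact: derivableM].
  have [f' Sf' ff'] := df k; have [g' Sg' gg'] := dg k.
  exists (fun x => f x * g' x + g x * f' x) => [|x Ox].
    by apply: fun_alg_add; apply: fun_alg_mul.
  have [_ dfx] := cf x Ox; have [_ dgx] := cg x Ox.
  by rewrite (@deriveM R _ f g)// ff'// gg'.
Qed.

Lemma cinfty_at m (O : set 'rV[R]_m) f x : cinfty O f -> O x ->
  {for x, continuous f} /\ forall k, derivable f x (basisv R k).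
Proof. by move=> cf Ox; exact: (cf [::]). Qed.

Lemma cinfty_fun_alg m (O : set 'rV[R]_m) f : open O ->
  fun_alg (cinfty O) f -> cinfty O f.
Proof.
move=> oO; apply: cinfty_alg => // {}f cf; split; first by move=> x; exact: cinfty_at.
by move=> k; exists (fun x => 'D_(basisv R k) f x) => //; apply: fun_alg_gen; exact: cinftyS.
Qed.

Lemma cinfty_eq m (O : set 'rV[R]_m) f g : open O ->
  (forall x, O x -> f x = g x) -> cinfty O f -> cinfty O g.
Proof.
move=> oO fg cf; apply: (@cinfty_coind _ _ (fun g => exists2 f, cinfty O f &
    forall x, O x -> f x = g x)); [exact: oO| |by exists f].
move=> {f g cf}g {}fg; case: fg => f cf fg; split=> [x Ox|k].
  have gf : {near x, f =1 g}.
    by near=> y; apply/fg; near: y; exact: open_nbhs_nbhs.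
  have [cfx dfx] := cinfty_at cf Ox.
  split=> [|k] /=; last exact: near_eq_derivable gf (dfx k).
  rewrite /prop_for /continuous_at -fg//; apply: cvg_trans cfx.
  exact: near_eq_cvg gf.
exists (fun x => 'D_(basisv R k) f x) => [|x Ox].
  by exists (fun x => 'D_(basisv R k) f x) => //; exact: cinftyS.
apply: near_eq_derive; near=> y; apply/esym/fg; near: y; exact: open_nbhs_nbhs.
Unshelve. all: by end_near. Qed.

Lemma cinfty_sub m (O O' : set 'rV[R]_m) (f : 'rV[R]_m -> R) :
  O `<=` O' -> cinfty O' f -> cinfty O f.
Proof. by move=> OO' cf s x /OO' /cf. Qed.

Lemma cinfty_cst m (O : set 'rV[R]_m) (c : R) : open O -> cinfty O (fun=> c).
Proof. by move=> oO; apply: cinfty_fun_alg => //; exact: fun_alg_cst. Qed.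

Lemma cinftyD m (O : set 'rV[R]_m) f g : open O -> cinfty O f -> cinfty O g ->
  cinfty O (fun x => f x + g x).
Proof.
by move=> oO cf cg; apply: cinfty_fun_alg => //; apply: fun_alg_add; exact: fun_alg_gen.
Qed.

Lemma cinftyM m (O : set 'rV[R]_m) f g : open O -> cinfty O f -> cinfty O g ->
  cinfty O (fun x => f x * g x).
Proof.
by move=> oO cf cg; apply: cinfty_fun_alg => //; apply: fun_alg_mul; exact: fun_alg_gen.
Qed.

Lemma cinfty_differentiable m (O : set 'rV[R]_m) f x : open O -> O x ->
  cinfty O f -> differentiable f x.
Proof.
move=> oO Ox cf; apply: (C1_differentiable oO Ox) => [y k Oy|k].
  by have [_] := cinfty_at cf Oy; apply.
by have [] := cinfty_at (@cinftyS _ _ _ k cf) Ox.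
Qed.

Lemma diff_basisE m (f : 'rV[R]_m -> R) x (v : 'rV[R]_m) : differentiable f x ->
  'D_v f x = \sum_k v 0 k * 'D_(basisv R k) f x.
Proof.
move=> df; rewrite deriveE// {1}(row_sum_delta v) linear_sum.
by apply: eq_bigr => k _; rewrite linearZ -deriveE.
Qed.

(** The derivative along [v] is that of a function of one real variable, to which
    the composition of differentials applies. *)
Lemma chain_rule n m (g : 'rV[R]_n -> 'rV[R]_m) (f : 'rV[R]_m -> R) x v :
  differentiable f (g x) -> derivable g x v ->
  derivable (f \o g) x v /\
  'D_v (f \o g) x =
    \sum_l 'D_(basisv R l) f (g x) * 'D_v (fun y => g y 0 l) x.
Proof.
move=> df dg.
have dl (h : 'rV[R]_n -> 'rV[R]_m) : derivable h x v ->
    differentiable (h \o (fun t : R => t *: v + x)) (0 : R).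
  by move=> /derivable1P /derivable1_diffP.
have E0 : (fun t : R => t *: v + x) 0 = x by rewrite scale0r add0r.
have dc := dl g dg.
have dfc : differentiable (f \o (g \o (fun t : R => t *: v + x))) (0 : R).
  by apply: differentiable_comp => //; rewrite /= E0.
split; first by apply/derivable1P/derivable1_diffP.
pose c t : 'rV[R]_n := t *: v + x.
have along (V : normedModType R) (h : 'rV[R]_n -> V) : 'D_v h x = 'D_1 (h \o c) (0 : R).
  rewrite /derive; set q1 := fun t : R => _; set q2 := fun t : R => _.
  suff -> : q1 = q2 by [].
  apply/funext => t; rewrite /q1 /q2 /= /c addr0 (mulr1 t : t *: 1 = t).
  by rewrite scale0r add0r.
rewrite along -[f \o g \o c]/(f \o (g \o c)) deriveE//.
rewrite diff_comp//; last by rewrite /= /c E0.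
rewrite (_ : (_ \o _) 1 = 'd f ((g \o c) 0) ('d (g \o c) 0 1))//.
rewrite -['d (g \o c) 0 1]deriveE// -along -deriveE /= /c ?scale0r ?add0r//.
rewrite (diff_basisE _ df); apply: eq_bigr => l _.
by rewrite mulrC derive_mx// mxE.
Qed.

Lemma fun_alg_sum m (G : ('rV[R]_m -> R) -> Prop) (I : Type) (r : seq I)
  (F : I -> 'rV[R]_m -> R) : (forall i, fun_alg G (F i)) ->
  fun_alg G (fun x => \sum_(i <- r) F i x).
Proof.
move=> H; elim: r => [|i r IH].
  rewrite (_ : (fun x => _) = fun=> 0); first exact: fun_alg_cst.
  by apply/funext => x; rewrite big_nil.
rewrite (_ : (fun x => _) = fun x => F i x + \sum_(i <- r) F i x).
  exact: fun_alg_add.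
by apply/funext => x; rewrite big_cons.
Qed.

Lemma near_continuous m (f : 'rV[R]_m -> R) (x : 'rV[R]_m) (e : R) : {for x, continuous f} ->
  0 < e -> \forall y \near x, `|f x - f y| <= e.
Proof. by move=> /cvgrPdist_le H e0; exact: H. Qed.

Lemma row_continuous n m (g : 'rV[R]_n -> 'rV[R]_m) (x : 'rV[R]_n) :
  (forall l, {for x, continuous (fun y => g y 0 l)}) -> {for x, continuous g}.
Proof.
move=> cg; have FF : Filter (nbhs (x : 'rV[R]_n)) := nbhs_filter x.
apply/(@cvgrPdist_le R 'rV[R]_m 'rV[R]_n (nbhs x) FF) => e e0.
have H : \forall y \near x, forall l, `|g x 0 l - g y 0 l| <= e.
  have H l := near_continuous (cg l) e0.
  exact: (@filter_forall _ _ _ (nbhs (x : 'rV[R]_n)) FF H).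
apply: filterS H => y Hy; apply: row_norm_le => [|l]; first exact: ltW.
by rewrite !mxE.
Qed.

(** By the chain rule, the smooth functions together with the composites [f \o g]
    generate an algebra that is stable under partial derivatives. *)
Lemma cinfty_comp n m (O : set 'rV[R]_n) (O' : set 'rV[R]_m)
  (g : 'rV[R]_n -> 'rV[R]_m) (f : 'rV[R]_m -> R) : open O -> open O' ->
  (forall x, O x -> O' (g x)) -> (forall l, cinfty O (fun x => g x 0 l)) ->
  cinfty O' f -> cinfty O (f \o g).
Proof.
move=> oO oO' OO' cg cf.
pose G h := cinfty O h \/ exists2 f, cinfty O' f & h = f \o g.
apply: (@cinfty_alg _ _ G); first exact: oO; last by apply: fun_alg_gen; right; exists f.
move=> {}f [{}cf|[{cf}f cf ->]].
  split; first by move=> x; exact: cinfty_at.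
  move=> k; exists (fun x => 'D_(basisv R k) f x) => //; apply: fun_alg_gen; left.
  exact: cinftyS.
have dg x k : O x -> derivable g x (basisv R k).
  move=> Ox; apply/derivable_mxP => i j; rewrite ord1.
  by have [_] := cinfty_at (cg j) Ox; apply.
have df x : O x -> differentiable f (g x).
  by move=> Ox; apply: (cinfty_differentiable oO' _ cf); exact: OO'.
split=> [x Ox|k].
  split=> [|k]; last by have [] := chain_rule (df x Ox) (dg x k Ox).
  apply: continuous_comp; last exact: (cinfty_at cf (OO' _ Ox)).1.
  apply: row_continuous => l; exact: (cinfty_at (cg l) Ox).1.
exists (fun x => \sum_l 'D_(basisv R l) f (g x) * 'D_(basisv R k) (fun y => g y 0 l) x).
  apply: (@fun_alg_sum _ _ _ (index_enum 'I_m)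
    (fun l x => 'D_(basisv R l) f (g x) * 'D_(basisv R k) (fun y => g y 0 l) x)) => l.
  apply: fun_alg_mul; apply: fun_alg_gen; last by left; exact: cinftyS.
  by right; exists (fun x => 'D_(basisv R l) f x) => //; exact: cinftyS.
by move=> x Ox; have [_] := chain_rule (df x Ox) (dg x k Ox).
Qed.

Lemma derive_diff m (f g : 'rV[R]_m -> R) (y v : 'rV[R]_m) :
  derivable f y v -> derivable g y v ->
  derivable (fun z => f z - g z) y v /\
  'D_v (fun z => f z - g z) y = 'D_v f y - 'D_v g y.
Proof. by move=> df dg; split; [exact: derivableB|exact: deriveB]. Qed.

Lemma derive_shift m (f : 'rV[R]_m -> R) (a y v : 'rV[R]_m) :
  derivable f (a + y) v ->
  derivable (fun z => f (a + z)) y v /\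
  'D_v (fun z => f (a + z)) y = 'D_v f (a + y).
Proof.
rewrite /derivable /derive; set q1 := fun t : R => _; set q2 := fun t : R => _.
suff -> : q1 = q2 by [].
by apply/funext => t; rewrite /q1 /q2 /= addrCA.
Qed.

(** By two applications of the mean value theorem, in either order of the variables,
    the second difference of [f] over a small square with corner [x] is the area of
    the square times a mixed derivative at a nearby point; continuity does the rest. *)
Lemma schwarz m (O : set 'rV[R]_m) (f : 'rV[R]_m -> R) x k l : open O -> O x ->
  cinfty O f ->
  'D_(basisv R k) (fun y => 'D_(basisv R l) f y) x =
  'D_(basisv R l) (fun y => 'D_(basisv R k) f y) x.
Proof.
move=> oO Ox cf.
have [D DE] : exists D : 'I_m -> 'I_m -> 'rV[R]_m -> R,
    forall i j, D i j = fun y => 'D_(basisv R i) (fun y => 'D_(basisv R j) f y) y.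
  by exists (fun i j y => 'D_(basisv R i) (fun y => 'D_(basisv R j) f y) y).
have cD i j : cinfty O (D i j) by rewrite DE; do 2!apply: cinftyS.
have DEx i j : 'D_(basisv R i) (fun y => 'D_(basisv R j) f y) x = D i j x by rewrite DE.
rewrite !DEx.
suff H e : 0 < e -> `|D k l x - D l k x| <= e + e.
  apply/eqP; rewrite -subr_eq0 -normr_le0; apply/ler_addgt0Pl => e e0.
  by rewrite addr0 (splitr e); apply: H; rewrite divr_gt0.
move=> e0.
have near_x : \forall y \near x, [/\ O y, `|D k l x - D k l y| <= e & `|D l k x - D l k y| <= e].
  have ck := near_continuous (cinfty_at (cD k l) Ox).1 e0.
  have cl := near_continuous (cinfty_at (cD l k) Ox).1 e0.
  have nO : \forall y \near x, O y by exact: open_nbhs_nbhs.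
  by apply: filterS (filterI nO (filterI ck cl)) => y [? [? ?]]; split.
move/nbhs_ballP : near_x => [d /= d0 Hd].
pose h := d / 4%:R.
have h0 : 0 < h by rewrite divr_gt0.
have close (i j : 'I_m) (s t : R) : `|s| <= `|h| -> `|t| <= `|h| ->
    ball x d (s *: basisv R i + (t *: basisv R j + x)).
  move=> sh th; rewrite -ball_normE /= addrA opprD addrCA subrr addr0 normrN.
  apply: (@le_lt_trans _ _ (h + h)); last by rewrite /h; lra.
  apply: le_trans (ler_normD _ _) _; rewrite (gtr0_norm h0) in sh th.
  by apply: lerD; rewrite normrZ; [apply: le_trans sh|apply: le_trans th];
    rewrite ler_piMr// basisv_norm.
pose Delta i j := f (h *: basisv R j + (h *: basisv R i + x)) - f (h *: basisv R i + x)
  - (f (h *: basisv R j + x) - f x).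
have hh : `|h| <= `|h| by [].
have z0 : `|0 : R| <= `|h| by rewrite normr0.
have dO y i : ball x d y -> derivable f y (basisv R i).
  by move=> /Hd[Oy _ _]; have [_] := cinfty_at cf Oy; apply.
have main i j : exists2 y, ball x d y & Delta i j = h * (h * D j i y).
  pose psi y := f (h *: basisv R j + y) - f y.
  have dpsi t : `|t| <= `|h| ->
      derivable psi (t *: basisv R i + x) (basisv R i) /\
      'D_(basisv R i) psi (t *: basisv R i + x) =
      'D_(basisv R i) f (h *: basisv R j + (t *: basisv R i + x)) -
      'D_(basisv R i) f (t *: basisv R i + x).
    move=> th.
    have [d1 E1] := @derive_shift m f (h *: basisv R j) _ _ (dO _ i (close j i h t hh th)).
    have d2 := dO _ i (close i i t 0 th z0); rewrite scale0r add0r in d2.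
    by have [d3 E3] := derive_diff d1 d2; split; [exact: d3|rewrite -E1; exact: E3].
  have [|t th] := @MVT_line m psi x (basisv R i) h; first by move=> t /dpsi[].
  rewrite (dpsi t th).2.
  have [|u uh ->] := @MVT_line m (fun y => 'D_(basisv R i) f y) (t *: basisv R i + x) (basisv R j) h.
    move=> u uh; have [Oy _ _] := Hd _ (close j i u t uh th).
    by have [_] := cinfty_at (@cinftyS _ _ _ i cf) Oy; apply.
  by exists (u *: basisv R j + (t *: basisv R i + x)); [exact: close|rewrite DE].
have sym : Delta k l = Delta l k.
  rewrite /Delta [in LHS](addrCA (h *: _)); ring.
have [y By E1] := main k l; have [z Bz E2] := main l k.
have E : D l k y = D k l z.
  move: sym; rewrite E1 E2 => /(mulfI (lt0r_neq0 h0)) /(mulfI (lt0r_neq0 h0)).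
  by [].
have [_ _ H1] := Hd _ By; have [_ H2 _] := Hd _ Bz.
rewrite -(subrKA (D k l z)); apply: le_trans (ler_normD _ _) _; apply: lerD => //.
by rewrite -E distrC.
Unshelve. all: by end_near. Qed.

End Calculus.
(** * Exterior algebra: creation, annihilation and the quantum product *)

Section ExteriorAlgebra.
Variables (R : realType) (m : nat).
Implicit Types (a b f : ext m R) (i j k : 'I_m) (I J K : {set 'I_m}).

(** The sign picked up by [e^i] when it moves past the smaller indices of [K]. *)
Definition ksign (i : 'I_m) (K : {set 'I_m}) : R :=
  (-1) ^+ #|[set k in K | (k < i)%N]%SET|.

Lemma ksign_sq i K : ksign i K * ksign i K = 1.
Proof. by rewrite /ksign -expr2 sqrr_sign. Qed.

Lemma ksignU1 i j K : j \notin K ->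
  ksign i (j |: K)%SET = (-1) ^+ (j < i)%N * ksign i K.
Proof.
move=> jK; rewrite /ksign -exprD; congr (_ ^+ _).
have [ji|ji] := boolP (j < i)%N.
  rewrite (_ : [set k in (j |: K)%SET | (k < i)%N]%SET =
               (j |: [set k in K | (k < i)%N])%SET); last first.
    by apply/setP => k; rewrite !inE; case: eqVneq => // ->; rewrite ji.
  by rewrite cardsU1 !inE (negbTE jK).
congr #|pred_of_set _|; apply/setP => k; rewrite !inE.
by case: eqVneq => // ->; rewrite (negbTE ji) (negbTE jK).
Qed.

Lemma ksignD1 i j K : j \in K ->
  ksign i (K :\ j)%SET = (-1) ^+ (j < i)%N * ksign i K.
Proof.
move=> jK; rewrite -{2}(finset.setD1K jK) ksignU1 ?finset.setD11//.
by rewrite mulrA -expr2 sqrr_sign mul1r.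
Qed.

Lemma lcontrE i a K :
  lcontr i a K = if i \in K then 0 else ksign i K * a (i |: K)%SET.
Proof. by rewrite ffunE. Qed.

Lemma wedge_edxE i a K :
  wedge (edx R i) a K = if i \in K then ksign i K * a (K :\ i)%SET else 0.
Proof.
rewrite ffunE; case: ifP => iK; last first.
  rewrite big1 // => I IK; rewrite ffunE; case: eqVneq => [IE|].
    by move: IK; rewrite IE finset.sub1set iK.
  by rewrite mulr0 mul0r.
rewrite (bigD1 [set i]%SET) ?finset.sub1set//= ffunE eqxx mulr1 big1 ?addr0.
  congr ((-1) ^+ _ * _).
  have inj : injective (fun k : 'I_m => (i, k)) by move=> x y [].
  rewrite /inversions -(card_imset _ inj).
  apply: eq_card => -[x y]; rewrite !inE /=; apply/idP/imsetP.
    case/and3P=> /eqP -> /andP[_ yK] yi; exists y => //.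
    by rewrite inE yK.
  case=> z; rewrite inE => /andP[zK zi] [-> ->]; rewrite eqxx zK zi /= !andbT.
  by apply: contraTneq zi => ->; rewrite ltnn.
move=> I /andP[_ /negbTE Ii]; by rewrite ffunE Ii mulr0 mul0r.
Qed.

Lemma wedge_is_linear a : linear (wedge a).
Proof.
move=> c u v; apply/ffunP => K; rewrite !ffunE scaler_sumr -big_split /=.
by apply: eq_bigr => I _; rewrite !ffunE /= mulrDr mulrCA.
Qed.
HB.instance Definition _ a :=
  GRing.isLinear.Build R (ext m R) (ext m R) _ (wedge a) (wedge_is_linear a).

Definition wedgel b a := wedge a b.
Lemma wedgel_is_linear b : linear (wedgel b).
Proof.
move=> c u v; apply/ffunP => K; rewrite !ffunE scaler_sumr -big_split /=.
by apply: eq_bigr => I _; rewrite !ffunE /= /GRing.scale /=; ring.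
Qed.
HB.instance Definition _ b :=
  GRing.isLinear.Build R (ext m R) (ext m R) _ (wedgel b) (wedgel_is_linear b).

Lemma lcontr_is_linear i : linear (@lcontr R m i).
Proof.
move=> c u v; apply/ffunP => K; rewrite !ffunE.
case: ifP => _; first by rewrite /GRing.scale /=; ring.
by rewrite /GRing.scale /=; ring.
Qed.
HB.instance Definition _ i :=
  GRing.isLinear.Build R (ext m R) (ext m R) _ (lcontr i) (lcontr_is_linear i).

Lemma bicontr_is_linear (w : 'M[R]_m) : linear (bicontr w).
Proof.
move=> c u v; rewrite /bicontr scalerA (mulrC c) -scalerA -scalerDr; congr (_ *: _).
rewrite scaler_sumr -big_split; apply: eq_bigr => k _.
rewrite scaler_sumr -big_split; apply: eq_bigr => l _.
by rewrite !linearP.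
Qed.
HB.instance Definition _ w :=
  GRing.isLinear.Build R (ext m R) (ext m R) _ (bicontr w) (bicontr_is_linear w).

Lemma wedgeZr a (c : R) b : wedge a (c *: b) = c *: wedge a b.
Proof. exact: linearZ. Qed.
Lemma wedgeZl (c : R) a b : wedge (c *: a) b = c *: wedge a b.
Proof. exact: (linearZ_LR (wedgel b)). Qed.
Lemma lcontrZ i (c : R) b : lcontr i (c *: b) = c *: lcontr i b.
Proof. exact: linearZ. Qed.
Lemma bicontrZ w (c : R) b : bicontr w (c *: b) = c *: bicontr w b.
Proof. exact: linearZ. Qed.
Lemma wedgeDr a b c : wedge a (b + c) = wedge a b + wedge a c.
Proof. exact: linearD. Qed.
Lemma wedgeDl a b c : wedge (a + b) c = wedge a c + wedge b c.
Proof. exact: (linearD (wedgel c)). Qed.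
Lemma wedgeBr a b c : wedge a (b - c) = wedge a b - wedge a c.
Proof. exact: linearB. Qed.
Lemma lcontrB i b c : lcontr i (b - c) = lcontr i b - lcontr i c.
Proof. exact: linearB. Qed.
Lemma bicontrB w b c : bicontr w (b - c) = bicontr w b - bicontr w c.
Proof. exact: linearB. Qed.
Lemma wedge_sumr a (T : finType) (F : T -> ext m R) :
  wedge a (\sum_x F x) = \sum_x wedge a (F x).
Proof. exact: linear_sum. Qed.
Lemma wedge_suml (T : finType) (F : T -> ext m R) b :
  wedge (\sum_x F x) b = \sum_x wedge (F x) b.
Proof. exact: (linear_sum (wedgel b)). Qed.
Lemma lcontr_sum i (T : finType) (F : T -> ext m R) :
  lcontr i (\sum_x F x) = \sum_x lcontr i (F x).
Proof. exact: linear_sum. Qed.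
Lemma bicontr_sum w (T : finType) (F : T -> ext m R) :
  bicontr w (\sum_x F x) = \sum_x bicontr w (F x).
Proof. exact: linear_sum. Qed.

(** Together with [lcontr_wedge_edx] and [wedge_edx_anti] these are the canonical
    anticommutation relations, from which the commutators below are computed. *)
Lemma lcontr_anti i j a : lcontr i (lcontr j a) = - lcontr j (lcontr i a).
Proof.
apply/ffunP => K; rewrite [RHS]ffunE !lcontrE !inE.
case: (boolP (i \in K)) => iK; case: (boolP (j \in K)) => jK;
  rewrite /= ?orbT ?mulr0 ?oppr0//.
case: (eqVneq i j) => [<-|ij]; first by rewrite /= mulr0 oppr0.
rewrite /= !ksignU1// [in RHS]finset.setUCA.
case: (ltngtP i j) => ij'; rewrite ?expr1 ?expr0; [ring|ring|].
by rewrite (val_inj ij') eqxx in ij.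
Qed.

Lemma lcontr_wedge_edx i j a :
  lcontr j (wedge (edx R i) a) =
    (i == j)%:R *: a - wedge (edx R i) (lcontr j a).
Proof.
apply/ffunP => K; rewrite lcontrE wedge_edxE ffunE [X in _ + X]ffunE ffunE.
rewrite wedge_edxE !lcontrE !inE /GRing.scale /=.
case: (eqVneq i j) => [<-|ij]; rewrite ?eqxx ?(negbTE ij) ?orbF /= ?mul1r ?mul0r.
  case: (boolP (i \in K)) => iK /=.
    rewrite ksignD1// ltnn mul1r mulrA ksign_sq mul1r (finset.setD1K iK).
    by rewrite subrr.
  rewrite ksignU1// ltnn mul1r mulrA ksign_sq mul1r finset.setU1K// subr0.
  by [].
rewrite add0r /=.
case: (boolP (j \in K)) => jK /=; first by case: ifP; rewrite ?mulr0 oppr0.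
case: (boolP (i \in K)) => iK /=; last by rewrite mulr0 oppr0.
rewrite ksignU1// ksignD1//.
have -> : ((j |: K) :\ i = j |: (K :\ i))%SET.
  apply/setP => x; rewrite !inE; case: (eqVneq x j) => [->|//].
  by rewrite eq_sym (negbTE ij).
case: (ltngtP i j) => ij'; rewrite ?expr1 ?expr0; [ring|ring|].
by rewrite (val_inj ij') eqxx in ij.
Qed.

Lemma wedge_edx_anti i j a :
  wedge (edx R i) (wedge (edx R j) a) = - wedge (edx R j) (wedge (edx R i) a).
Proof.
apply/ffunP => K; rewrite [RHS]ffunE !wedge_edxE !inE.
case: (boolP (i \in K)) => iK; case: (boolP (j \in K)) => jK;
  rewrite /= ?andbF ?mulr0 ?oppr0//.
case: (eqVneq i j) => [<-|ij]; first by rewrite /= mulr0 oppr0.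
rewrite /= !ksignD1//.
have -> : ((K :\ i) :\ j = (K :\ j) :\ i)%SET.
  by apply/setP => x; rewrite !inE andbCA.
case: (ltngtP i j) => ij'; rewrite ?expr1 ?expr0; [ring|ring|].
by rewrite (val_inj ij') eqxx in ij.
Qed.

(** This instance of associativity expresses products of forms of positive degree
    through the operators [wedge (edx R i)]. *)
Lemma wedge_edxA i a b :
  wedge (wedge (edx R i) a) b = wedge (edx R i) (wedge a b).
Proof.
apply/ffunP => K; rewrite wedge_edxE ffunE.
case: (boolP (i \in K)) => iK; last first.
  rewrite big1 // => I IK; rewrite wedge_edxE ifF ?mulr0 ?mul0r//.
  by apply/negP => /(fintype.subsetP IK); apply/negP.
rewrite ffunE mulr_sumr (bigID (fun I => i \in I)) /= addrC big1 ?add0r; last first.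
  by move=> I /andP[_ /negbTE iI]; rewrite wedge_edxE iI mulr0 mul0r.
rewrite (reindex_onto (fun J => i |: J)%SET (fun I => I :\ i)%SET); last first.
  by move=> I /andP[_ iI]; rewrite finset.setD1K.
apply: eq_big => [J|J /andP[/andP[JK _] /eqP JE]].
  rewrite finset.setU11 andbT finset.subUset finset.sub1set iK /= finset.subsetD1.
  apply: andb_id2l => _; apply/eqP/idP => [<-|iJ]; first by rewrite !inE eqxx.
  by rewrite finset.setU1K.
have iJ : i \notin J by rewrite -JE !inE eqxx.
rewrite wedge_edxE finset.setU11 JE.
have KE : (K :\: (i |: J) = (K :\ i) :\: J)%SET.
  by apply/setP => x; rewrite !inE negb_or -!andbA andbCA.
rewrite KE; set L := ((K :\ i) :\: J)%SET.
have -> : inversions (i |: J)%SET L =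
    (inversions J L + #|[set k in L | (k < i)%N]%SET|)%N.
  have inj : injective (fun k : 'I_m => (i, k)) by move=> x y [].
  rewrite /inversions -(card_imset [set k in L | (k < i)%N]%SET inj) addnC.
  rewrite -cardsUI [X in (_ + X)%N](_ : _ = 0%N) ?addn0.
    apply: eq_card => -[x y]; rewrite !inE /=; apply/idP/idP.
      case/and3P=> /orP[/eqP->|xJ] yL yx.
        by apply/orP; left; apply/imsetP; exists y => //; rewrite inE yx andbT !inE.
      by rewrite xJ yL yx orbT.
    case/orP=> [/imsetP[z]|/and3P[-> -> ->]]; last by rewrite orbT.
    by rewrite inE => /andP[zL zi] [-> ->]; rewrite eqxx zi andbT /=; rewrite !inE in zL.
  apply/eqP; rewrite cards_eq0; apply/eqP/setP => -[x y]; rewrite !inE /=.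
  apply/negbTE/negP => /andP[/imsetP[z _ [-> _]]].
  by rewrite (negbTE iJ).
rewrite ksignU1// ltnn mul1r exprD.
have -> : ksign i K = (-1) ^+ #|[set k in L | (k < i)%N]%SET| * ksign i J.
  rewrite /ksign -exprD; congr (_ ^+ _).
  rewrite -cardsUI [X in (_ + X)%N](_ : _ = 0%N) ?addn0.
    apply: eq_card => x; rewrite !inE.
    have [->|xi] := eqVneq x i; first by rewrite ltnn !andbF.
    case: (x < i)%N; rewrite ?andbF// !andbT.
    case: (boolP (x \in J)) => //= xJ; rewrite ?orbF//.
    have : x \in (i |: J)%SET by rewrite !inE xJ orbT.
    by move/(fintype.subsetP JK) ->.
  apply/eqP; rewrite cards_eq0; apply/eqP/setP => x; rewrite !inE.
  by case: (x \in J); rewrite ?andbF.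
ring.
Qed.

Lemma lcontr_edx i j : lcontr i (edx R j) = (i == j)%:R *: ext1 R m.
Proof.
apply/ffunP => K; rewrite lcontrE !ffunE /GRing.scale /=.
have [->|K0] := eqVneq K finset.set0.
  rewrite finset.in_set0 finset.setU0 (inj_eq (@finset.set1_inj _)) mulr1.
  by rewrite /ksign (_ : [set _ in _ | _]%SET = finset.set0) ?cards0 ?mul1r//;
     apply/setP => x; rewrite !inE.
rewrite mulr0; case: ifP => // iK; case: eqVneq; rewrite ?mulr0// => E.
case/finset.set0Pn: K0 => x xK.
have : x \in (i |: K)%SET by rewrite !inE xK orbT.
rewrite E inE => /eqP xj.
have : i \in (i |: K)%SET by rewrite !inE eqxx.
by rewrite E inE => /eqP ij; rewrite ij -xj xK in iK.
Qed.

Lemma lcontr_ext1 i : lcontr i (ext1 R m) = 0.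
Proof.
apply/ffunP => K; rewrite lcontrE !ffunE; case: ifP => // iK.
by case: eqVneq => [E|]; rewrite ?mulr0//; have := finset.setU11 i K; rewrite E inE.
Qed.

Lemma wedge_ext1 b : wedge (ext1 R m) b = b.
Proof.
apply/ffunP => K; rewrite ffunE (bigD1 finset.set0) ?finset.sub0set//= big1.
  rewrite addr0 ffunE eqxx finset.setD0 /inversions.
  rewrite (_ : [set _ | _]%SET = finset.set0) ?cards0 ?mul1r//.
  by apply/setP => x; rewrite !inE.
by move=> I /andP[_ /negbTE I0]; rewrite ffunE I0 mulr0 mul0r.
Qed.

Lemma wedge_ext1r a : wedge a (ext1 R m) = a.
Proof.
apply/ffunP => K; rewrite ffunE (bigD1 K)//= big1.
  rewrite addr0 ffunE finset.setDv eqxx mulr1 /inversions.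
  rewrite (_ : [set _ | _]%SET = finset.set0) ?cards0 ?mul1r//.
  by apply/setP => x; rewrite !inE andbF.
move=> I /andP[IK nIK]; rewrite ffunE [_ == _](_ : _ = false) ?mulr0//.
by apply/negbTE; apply: contra nIK; rewrite finset.setD_eq0 finset.eqEsubset IK.
Qed.

Lemma wedge_edx_ext1 i : wedge (edx R i) (ext1 R m) = edx R i.
Proof.
apply/ffunP => K; rewrite wedge_edxE !ffunE.
case: ifP => iK; last first.
  by case: eqVneq => // E; move: iK; rewrite E inE eqxx.
have -> : ((K :\ i)%SET == finset.set0) = (K == [set i]%SET).
  apply/eqP/eqP => [E|->]; last by rewrite finset.setDv.
  by rewrite -(finset.setD1K iK) E finset.setU0.
case: eqVneq => [->|]; rewrite ?mulr0// /ksign.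
rewrite (_ : [set _ in _ | _]%SET = finset.set0) ?cards0 ?mul1r//.
by apply/setP => x; rewrite !inE; case: eqVneq => // ->; rewrite ltnn.
Qed.

(** Contraction into the last slot differs from contraction into the first one
    by the sign of moving a slot past the others. *)
Lemma rcontrE a i K : rcontr a i K = (-1) ^+ #|K| * lcontr i a K.
Proof.
rewrite lcontrE ffunE; case: ifP => iK; rewrite ?mulr0// mulrA; congr (_ * _).
have -> : #|K| = (#|[set k in K | (i < k)%N]%SET| + #|[set k in K | (k < i)%N]%SET|)%N.
  rewrite -cardsUI [X in (_ + X)%N](_ : _ = 0%N) ?addn0.
    apply: eq_card => x; rewrite !inE -andb_orr.
    by case: ltngtP => [||/val_inj <-]; rewrite ?andbT ?iK.
  apply/eqP; rewrite cards_eq0; apply/eqP/setP => x; rewrite !inE.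
  by case: ltngtP; rewrite ?andbF.
by rewrite exprD -mulrA -expr2 sqrr_sign mulr1.
Qed.


Definition pure p a := forall K, a K != 0 -> #|K| = p.

Lemma pure_eq0 p a K : pure p a -> #|K| != p -> a K = 0.
Proof. by move=> pa Kp; apply/eqP; apply: contraNT Kp => /pa ->. Qed.

Lemma pureP p a : (forall K, #|K| != p -> a K = 0) -> pure p a.
Proof. by move=> H K aK; apply/eqP; apply: contraNT aK => /H ->. Qed.

Lemma pure0 p : pure p 0.
Proof. by move=> K; rewrite ffunE eqxx. Qed.

Lemma pureZ p (c : R) a : pure p a -> pure p (c *: a).
Proof.
by move=> pa; apply: pureP => K Kp; rewrite ffunE (pure_eq0 pa)// scaler0.
Qed.

Lemma pureN p a : pure p a -> pure p (- a).
Proof. by rewrite -scaleN1r; apply: pureZ. Qed.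

Lemma pureD p a b : pure p a -> pure p b -> pure p (a + b).
Proof.
move=> pa pb; apply: pureP => K Kp.
by rewrite ffunE (pure_eq0 pa)// (pure_eq0 pb)// addr0.
Qed.

Lemma pure_sum p (I : Type) (r : seq I) (P : pred I) (F : I -> ext m R) :
  (forall x, P x -> pure p (F x)) -> pure p (\sum_(x <- r | P x) F x).
Proof. by move=> H; elim/big_ind: _ => //; [exact: pure0|exact: pureD]. Qed.

Lemma pure_lcontr p i a : pure p.+1 a -> pure p (lcontr i a).
Proof.
move=> pa; apply: pureP => K Kp; rewrite lcontrE; case: ifP => // iK.
by rewrite (pure_eq0 pa) ?mulr0// cardsU1 iK add1n eqSS.
Qed.

Lemma pure_wedge_edx p i a : pure p a -> pure p.+1 (wedge (edx R i) a).
Proof.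
move=> pa; apply: pureP => K Kp; rewrite wedge_edxE; case: ifP => // iK.
rewrite (pure_eq0 pa) ?mulr0//; apply: contra_neq Kp => <-.
by rewrite (cardsD1 i K) iK.
Qed.

Lemma pure0_lcontr i a : pure 0 a -> lcontr i a = 0.
Proof.
move=> pa; apply/ffunP => K; rewrite lcontrE ffunE; case: ifP => // iK.
by rewrite (pure_eq0 pa) ?mulr0// cardsU1 iK.
Qed.

Lemma rcontr_pure p i a : pure p.+1 a -> rcontr a i = (-1) ^+ p *: lcontr i a.
Proof.
move=> pa; apply/ffunP => K; rewrite rcontrE [RHS]ffunE.
have [->//|Kp] := eqVneq #|K| p.
by rewrite (pure_eq0 (pure_lcontr (i:=i) pa))// mulr0 scaler0.
Qed.

Lemma pure0_rcontr i a : pure 0 a -> rcontr a i = 0.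
Proof.
move=> pa; apply/ffunP => K; rewrite rcontrE pure0_lcontr// !ffunE mulr0.
by [].
Qed.

Lemma zero_form a : pure 0 a -> a = a finset.set0 *: ext1 R m.
Proof.
move=> pa; apply/ffunP => K; rewrite !ffunE.
have [->|K0] := eqVneq K finset.set0; first by rewrite /GRing.scale /= mulr1.
rewrite [LHS](pure_eq0 pa) ?cards_eq0//; exact/esym/scaler0.
Qed.

(** The Euler identity; it recovers a 1-form or a 2-form from its contractions. *)
Lemma euler_degree p a : pure p a ->
  \sum_i wedge (edx R i) (lcontr i a) = p%:R *: a.
Proof.
move=> pa; apply/ffunP => K; rewrite sum_ffunE ffunE.
rewrite (eq_bigr (fun i => if i \in K then a K else 0)); last first.
  move=> i _; rewrite wedge_edxE; case: ifP => // iK.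
  rewrite lcontrE !inE eqxx /= ksignD1// ltnn mul1r mulrA ksign_sq mul1r.
  by rewrite finset.setD1K.
rewrite -big_mkcond /= sumr_const /GRing.scale /= mulr_natl.
by have [->//|Kp] := eqVneq #|K| p; rewrite (pure_eq0 pa)// !mul0rn.
Qed.

Lemma one_form a : pure 1 a -> a = \sum_i a [set i]%SET *: edx R i.
Proof.
move=> pa; rewrite -[LHS]scale1r -(euler_degree pa); apply: eq_bigr => i _.
rewrite (zero_form (pure_lcontr (i:=i) pa)) linearZ /= wedge_edx_ext1.
congr (_ *: _); rewrite lcontrE finset.in_set0 finset.setU0.
by rewrite /ksign (_ : [set _ in _ | _]%SET = finset.set0) ?cards0 ?mul1r//;
  apply/setP => x; rewrite !inE.
Qed.

Lemma wedge_one_form a b : pure 1 a ->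
  wedge a b = \sum_i a [set i]%SET *: wedge (edx R i) b.
Proof.
move=> pa; rewrite {1}(one_form pa) -/(wedgel b _) linear_sum.
by apply: eq_bigr => i _; rewrite linearZ.
Qed.

(** The alternating coefficients of a 2-form. *)
Definition coef2 a i j : R := lcontr j (lcontr i a) finset.set0.

Lemma coef2_anti a i j : coef2 a i j = - coef2 a j i.
Proof. by rewrite /coef2 lcontr_anti ffunE. Qed.

Lemma lcontr_set0 i a : lcontr i a finset.set0 = a [set i]%SET.
Proof.
rewrite lcontrE finset.in_set0 finset.setU0.
by rewrite /ksign (_ : [set _ in _ | _]%SET = finset.set0) ?cards0 ?mul1r//;
  apply/setP => x; rewrite !inE.
Qed.

Lemma wedge_two_form a b : pure 2 a ->
  wedge a b =
    2^-1 *: \sum_i \sum_j coef2 a i j *: wedge (edx R i) (wedge (edx R j) b).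
Proof.
move=> pa; have {1}-> : a = 2^-1 *: \sum_i wedge (edx R i) (lcontr i a).
  by rewrite (euler_degree pa) scalerA mulVf ?pnatr_eq0// scale1r.
rewrite -/(wedgel b _) linearZ linear_sum /=; congr (_ *: _).
apply: eq_bigr => i _; rewrite /wedgel wedge_edxA.
rewrite (wedge_one_form _ (pure_lcontr (i:=i) pa)) linear_sum.
by apply: eq_bigr => j _; rewrite linearZ /= /coef2 lcontr_set0.
Qed.

(** Contraction with the vector [w(e^i, -)]. *)
Definition sharp (w : 'M[R]_m) i b : ext m R := \sum_l w i l *: lcontr l b.

Lemma sharp_is_linear w i : linear (sharp w i).
Proof.
move=> c u v; rewrite /sharp scaler_sumr -big_split; apply: eq_bigr => l _.
by rewrite !linearP.
Qed.
HB.instance Definition _ w i :=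
  GRing.isLinear.Build R (ext m R) (ext m R) _ (sharp w i) (sharp_is_linear w i).

Lemma antisymE (w : 'M[R]_m) i j : w^T = - w -> w i j = - w j i.
Proof. by move=> /matrixP /(_ j i); rewrite !mxE. Qed.

(** The commutator with [w |- _], which expresses all the terms in [h] below. *)
Definition com (w : 'M[R]_m) (T : ext m R -> ext m R) b : ext m R :=
  bicontr w (T b) - T (bicontr w b).

Lemma half_double (v : ext m R) : v = 2^-1 *: (v + v).
Proof. by rewrite scalerDr -scalerDl -[2^-1]mul1r -splitr scale1r. Qed.

Lemma com_edx w i b : w^T = - w -> com w (wedge (edx R i)) b = - sharp w i b.
Proof.
move=> wA; rewrite /com /bicontr wedgeZr -scalerBr wedge_sumr -sumrB.
have -> : \sum_k (\sum_l w k l *: lcontr k (lcontr l (wedge (edx R i) b)) -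
    wedge (edx R i) (\sum_l w k l *: lcontr k (lcontr l b))) =
  \sum_k (w k i *: lcontr k b - \sum_l (i == k)%:R *: (w k l *: lcontr l b)).
  apply: eq_bigr => k _; rewrite wedge_sumr -sumrB.
  have -> : w k i *: lcontr k b = \sum_l (i == l)%:R *: (w k l *: lcontr k b).
    rewrite (bigD1 i)//= eqxx scale1r big1 ?addr0// => l /negbTE li.
    by rewrite eq_sym li scale0r.
  rewrite -sumrB; apply: eq_bigr => l _.
  rewrite wedgeZr -scalerBr lcontr_wedge_edx lcontrB lcontrZ.
  rewrite lcontr_wedge_edx !scalerBr !scalerA ![_ * w k l]mulrC.
  by rewrite -addrA -opprD subrK.
rewrite sumrB /sharp.
have -> : \sum_k \sum_l (i == k)%:R *: (w k l *: lcontr l b) =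
    \sum_l w i l *: lcontr l b.
  rewrite (bigD1 i)//= eqxx [X in _ + X]big1 ?addr0; last first.
    move=> k /negbTE ki; apply: big1 => l _; by rewrite eq_sym ki scale0r.
  by apply: eq_bigr => l _; rewrite scale1r.
have -> : \sum_k w k i *: lcontr k b = - \sum_k w i k *: lcontr k b.
  by rewrite -sumrN; apply: eq_bigr => k _; rewrite (antisymE k i wA) scaleNr.
exact/esym/half_double.
Qed.

Lemma bicontr_edx w i b : w^T = - w ->
  bicontr w (wedge (edx R i) b) = wedge (edx R i) (bicontr w b) - sharp w i b.
Proof. by move=> wA; rewrite -com_edx// /com addrC subrK. Qed.

Lemma bicontr_lcontr w i b : bicontr w (lcontr i b) = lcontr i (bicontr w b).
Proof.
rewrite /bicontr lcontrZ lcontr_sum; congr (_ *: _); apply: eq_bigr => k _.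
rewrite lcontr_sum; apply: eq_bigr => l _; rewrite lcontrZ; congr (_ *: _).
by rewrite (lcontr_anti l) linearN /= (lcontr_anti k) opprK.
Qed.

Lemma bicontr_sharp w w' i b : bicontr w (sharp w' i b) = sharp w' i (bicontr w b).
Proof.
by rewrite bicontr_sum; apply: eq_bigr => l _; rewrite bicontrZ bicontr_lcontr.
Qed.

Lemma sharp_edx w i j b :
  sharp w i (wedge (edx R j) b) = w i j *: b - wedge (edx R j) (sharp w i b).
Proof.
rewrite /sharp wedge_sumr.
have -> : w i j *: b = \sum_l (j == l)%:R *: (w i l *: b).
  rewrite (bigD1 j)//= eqxx scale1r big1 ?addr0// => l /negbTE lj.
  by rewrite eq_sym lj scale0r.
rewrite -sumrB; apply: eq_bigr => l _.
by rewrite lcontr_wedge_edx wedgeZr scalerBr !scalerA mulrC.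
Qed.


Lemma qterm0 w a b : qterm w 0 a b = wedge a b.
Proof.
rewrite /qterm (bigD1 [tuple])//= [X in _ + X]big1 ?addr0; last first.
  by move=> t /negP[]; rewrite (tuple0 t).
rewrite (bigD1 [tuple])//= [X in _ + X]big1 ?addr0; last first.
  by move=> t /negP[]; rewrite (tuple0 t).
by rewrite big_ord0 scale1r.
Qed.

Lemma sum_tupleS n (V : nmodType) (F : n.+1.-tuple 'I_m -> V) :
  \sum_(t : n.+1.-tuple 'I_m) F t = \sum_i \sum_(t : n.-tuple 'I_m) F [tuple of i :: t].
Proof.
rewrite pair_big (reindex (fun p : 'I_m * n.-tuple 'I_m => [tuple of p.1 :: p.2]))//=.
exists (fun t : n.+1.-tuple 'I_m => (thead t, [tuple of behead t])).
  by move=> [x t] _ /=; congr (_, _); apply/val_inj.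
by move=> t _; rewrite [RHS]tuple_eta; apply/val_inj.
Qed.

(** Splitting off the first index pair: the iterated contractions become accessible
    to induction on [n]. *)
Lemma qtermS w n a b :
  qterm w n.+1 a b =
    \sum_i \sum_j w i j *: qterm w n (rcontr a i) (lcontr j b).
Proof.
rewrite /qterm sum_tupleS; apply: eq_bigr => i _.
under eq_bigr do rewrite sum_tupleS.
rewrite exchange_big; apply: eq_bigr => j _.
rewrite scaler_sumr; apply: eq_bigr => t _; rewrite scaler_sumr.
apply: eq_bigr => u _; rewrite scalerA big_ord_recl /= !tnth0; congr (_ * _ *: _).
by apply: eq_bigr => l _; rewrite !tnthS.
Qed.

(** Each contraction lowers the degree of [a] by one. *)
Lemma qterm_pure_eq0 w p n a b : pure p a -> (p < n)%N -> qterm w n a b = 0.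
Proof.
elim: n p a b => // n IH [|p] a b pa; rewrite ?ltnS => pn; rewrite qtermS;
    apply: big1 => i _; apply: big1 => j _.
  rewrite pure0_rcontr//; case: n IH pn => [|n] IH _.
    by rewrite qterm0 -[0](scale0r (0 : ext m R)) wedgeZl !scale0r scaler0.
  by rewrite (IH 0%N) ?scaler0//; exact: pure0.
rewrite (IH p) ?scaler0//; rewrite (rcontr_pure _ pa); exact/pureZ/pure_lcontr.
Qed.

Lemma qterm1_one_form w a b : pure 1 a ->
  qterm w 1 a b = \sum_i a [set i]%SET *: sharp w i b.
Proof.
move=> pa; rewrite qtermS; apply: eq_bigr => i _; rewrite scaler_sumr.
apply: eq_bigr => j _; rewrite qterm0 (rcontr_pure _ pa) scale1r.
rewrite (zero_form (pure_lcontr (i:=i) pa)) lcontr_set0 wedgeZl wedge_ext1.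
by rewrite !scalerA mulrC.
Qed.

Lemma com_one_form w a b : w^T = - w -> pure 1 a ->
  com w (wedge a) b = - qterm w 1 a b.
Proof.
move=> wA pa; rewrite qterm1_one_form// /com !(wedge_one_form _ pa) bicontr_sum.
rewrite -sumrB -sumrN; apply: eq_bigr => i _.
by rewrite bicontrZ -scalerBr -scalerN -com_edx.
Qed.

Lemma qterm1_two_form w a b : pure 2 a ->
  qterm w 1 a b =
    - \sum_i \sum_j coef2 a i j *: wedge (edx R j) (sharp w i b).
Proof.
move=> pa; rewrite qtermS -sumrN; apply: eq_bigr => i _.
rewrite (rcontr_pure _ pa) expr1 scaleN1r -sumrN.
under eq_bigr => l _.
  rewrite qterm0 -scaleN1r wedgeZl (wedge_one_form _ (pure_lcontr (i:=i) pa)).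
  rewrite scaleN1r scalerN; over.
rewrite sumrN -sumrN; under [RHS]eq_bigr => j _.
  rewrite /sharp wedge_sumr scaler_sumr; over.
rewrite [RHS]sumrN [in RHS]exchange_big -sumrN; apply: eq_bigr => l _.
rewrite scaler_sumr; congr (- _); apply: eq_bigr => j _.
by rewrite wedgeZr /coef2 lcontr_set0 !scalerA mulrC.
Qed.

Lemma qterm_sumr w n a (T : finType) (F : T -> ext m R) :
  qterm w n a (\sum_x F x) = \sum_x qterm w n a (F x).
Proof.
elim: n a T F => [|n IH] a T F.
  by rewrite qterm0 wedge_sumr; apply: eq_bigr => x _; rewrite qterm0.
rewrite qtermS; under [RHS]eq_bigr do rewrite qtermS.
rewrite [RHS]exchange_big; apply: eq_bigr => i _.
rewrite [RHS]exchange_big; apply: eq_bigr => j _.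
by rewrite lcontr_sum IH scaler_sumr.
Qed.

Lemma qtermZr w n a (c : R) b : qterm w n a (c *: b) = c *: qterm w n a b.
Proof.
elim: n a b => [|n IH] a b; first by rewrite !qterm0 wedgeZr.
rewrite !qtermS scaler_sumr; apply: eq_bigr => i _; rewrite scaler_sumr.
by apply: eq_bigr => j _; rewrite lcontrZ IH !scalerA mulrC.
Qed.

Lemma qterm0r w n a : qterm w n a 0 = 0.
Proof. by rewrite -[X in qterm _ _ _ X](scale0r (0 : ext m R)) qtermZr scale0r. Qed.

Lemma qterm2_two_form w a b : pure 2 a ->
  qterm w 2 a b =
    - \sum_i \sum_j coef2 a i j *: sharp w j (sharp w i b).
Proof.
move=> pa; rewrite qtermS -sumrN; apply: eq_bigr => i _.
under eq_bigr do rewrite -qtermZr.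
rewrite -qterm_sumr -/(sharp w i b) (rcontr_pure _ pa) expr1.
rewrite qterm1_one_form; last exact/pureZ/pure_lcontr.
by rewrite -sumrN; apply: eq_bigr => j _; rewrite ffunE scaleN1r scaleNr /coef2 lcontr_set0.
Qed.

Lemma com_two_form w a b : w^T = - w -> pure 2 a ->
  com w (wedge a) b = wedge (bicontr w a) b - qterm w 1 a b.
Proof.
move=> wA pa.
have -> : wedge (bicontr w a) b =
    - (2^-1 *: \sum_i \sum_j (coef2 a i j * w i j) *: b).
  rewrite /bicontr wedgeZl -scalerN; congr (_ *: _).
  rewrite wedge_suml -sumrN; apply: eq_bigr => i _.
  rewrite wedge_suml -sumrN; apply: eq_bigr => j _.
  rewrite wedgeZl (zero_form (pure_lcontr (pure_lcontr pa))) -/(coef2 a j i).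
  by rewrite coef2_anti wedgeZl wedge_ext1 scaleNr scalerN scalerA mulrC.
rewrite qterm1_two_form// opprK /com !(wedge_two_form _ pa) bicontrZ -scalerBr.
have -> : \sum_i \sum_j coef2 a i j *: wedge (edx R j) (sharp w i b) =
  2^-1 *: (\sum_i \sum_j coef2 a i j *: wedge (edx R j) (sharp w i b) -
           \sum_i \sum_j coef2 a i j *: wedge (edx R i) (sharp w j b)).
  rewrite [X in _ - X]exchange_big /=.
  have -> : \sum_j \sum_i coef2 a i j *: wedge (edx R i) (sharp w j b) =
     - \sum_i \sum_j coef2 a i j *: wedge (edx R j) (sharp w i b).
    rewrite -sumrN; apply: eq_bigr => i _; rewrite -sumrN.
    by apply: eq_bigr => j _; rewrite coef2_anti scaleNr.
  rewrite opprK; exact: half_double.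
rewrite -scalerN -scalerDr; congr (_ *: _).
rewrite bicontr_sum addrA -!sumrN -!big_split /=; apply: eq_bigr => i _.
rewrite bicontr_sum -!sumrN -!big_split /=; apply: eq_bigr => j _.
rewrite bicontrZ -scalerA -!scalerN -!scalerDr; congr (_ *: _).
rewrite bicontr_edx// bicontr_edx// wedgeBr sharp_edx.
rewrite scalerN opprB [LHS]addrAC [X in X + _ = _]addrAC subrr add0r [LHS]addrC.
by congr (_ - _); exact: addrC.
Qed.

Lemma com_com_two_form w a b : w^T = - w -> pure 2 a ->
  com w (com w (wedge a)) b = qterm w 2 a b.
Proof.
move=> wA pa.
have -> : com w (com w (wedge a)) b =
    bicontr w (com w (wedge a) b) - com w (wedge a) (bicontr w b) by [].
rewrite !com_two_form// bicontrB.
have pw : pure 0 (bicontr w a).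
  by apply: pureZ; apply: pure_sum => i _; apply: pure_sum => j _; apply: pureZ;
     do 2!apply: pure_lcontr.
rewrite (zero_form pw) !wedgeZl bicontrZ !wedge_ext1.
rewrite opprB addrC addrA subrK qterm2_two_form// !qterm1_two_form//.
rewrite [bicontr w (- _)]linearN /= opprK addrC bicontr_sum -sumrB -sumrN; apply: eq_bigr => i _.
rewrite bicontr_sum -sumrB -sumrN; apply: eq_bigr => j _.
rewrite bicontrZ bicontr_edx// bicontr_sharp -scalerBr -scalerN; congr (_ *: _).
by rewrite addrAC subrr add0r.
Qed.

(** ** Powers of h *)

(** The coefficients of [h^k b]. *)
Definition hshift (k : nat) (b : nat -> ext m R) (n : nat) : ext m R :=
  if (k <= n)%N then b (n - k)%N else 0.

Lemma sum_ord_trunc (V : nmodType) (G : nat -> V) A B :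
  (forall n, (A <= n)%N -> G n = 0) -> (forall n, (B <= n)%N -> G n = 0) ->
  \sum_(n < A) G n = \sum_(n < B) G n.
Proof.
wlog AB : A B / (A <= B)%N.
  by move=> H GA GB; case/orP: (leq_total A B) => AB; [|apply/esym]; exact: H.
move=> GA GB; rewrite (big_ord_widen _ _ AB) big_mkcond; apply: eq_bigr => n _.
by case: ltnP => // /GA.
Qed.

(** The constraint [n + p + q = N] is absorbed into a shift of [b]. *)
Lemma qwedgeE w (a b : nat -> ext m R) N :
  qwedge w a b N =
    \sum_(n < N.+1) \sum_(p < N.+1)
      (n`!%:R)^-1 *: qterm w n (a p) (hshift (n + p) b N).
Proof.
rewrite /qwedge; apply: eq_bigr => n _; apply: eq_bigr => p _.
rewrite /hshift; case: leqP => npN.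
  have q : (N - (n + p) < N.+1)%N by rewrite ltnS leq_subr.
  rewrite (bigD1 (Ordinal q)) /= ?subnKC// big1 ?addr0//.
  move=> i /andP[/eqP iN /negP[]]; apply/eqP/val_inj/esym/eqP => /=.
  by rewrite -(eqn_add2l (n + p)) iN subnKC.
rewrite qterm0r scaler0 big1// => i /eqP iN.
by move: npN; rewrite ltnNge -[X in (_ <= X)%N]iN leq_addr.
Qed.

Lemma qwedge_trunc w (a b : nat -> ext m R) N A B :
  (forall p, (B <= p)%N -> a p = 0) ->
  (forall p n, (A <= n)%N -> qterm w n (a p) =1 fun=> 0) ->
  qwedge w a b N =
    \sum_(n < A) \sum_(p < B)
      (n`!%:R)^-1 *: qterm w n (a p) (hshift (n + p) b N).
Proof.
move=> aB qA; rewrite qwedgeE.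
have q0 n : qterm w n 0 =1 fun=> 0.
  move=> c; case: n => [|n]; last by rewrite (@qterm_pure_eq0 _ 0)//; exact: pure0.
  by rewrite qterm0 -[X in wedge X](scale0r (0 : ext m R)) wedgeZl scale0r.
rewrite (sum_ord_trunc (B := A)
  (G := fun n => \sum_(p < N.+1) (n`!%:R)^-1 *: qterm w n (a p) (hshift (n + p) b N))).
- apply: eq_bigr => n _; apply: (sum_ord_trunc
    (G := fun p => (n`!%:R)^-1 *: qterm w n (a p) (hshift (n + p) b N))) => p Hp.
    by rewrite /hshift leqNgt (leq_trans Hp (leq_addl _ _)) qterm0r scaler0.
  by rewrite aB// q0 scaler0.
- move=> n Hn; apply: big1 => p _.
  by rewrite /hshift leqNgt (leq_trans Hn (leq_addr _ _)) qterm0r scaler0.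
- by move=> n Hn; apply: big1 => p _; rewrite qA// scaler0.
Qed.

Lemma hshift0 (b : nat -> ext m R) N : hshift 0 b N = b N.
Proof. by rewrite /hshift subn0. Qed.

Lemma qwedge_one_form w a (b : nat -> ext m R) N : w^T = - w -> pure 1 a ->
  qwedge w (hconst a) b N = wedge a (b N) - com w (wedge a) (hshift 1 b N).
Proof.
move=> wA pa; rewrite (@qwedge_trunc _ _ _ _ 2 1) => [|[]//|[|p] n n2 c].
- rewrite !big_ord_recl !big_ord0 /= !addr0 com_one_form// opprK qterm0 hshift0.
  by rewrite fact0 (_ : bump 0 0 = 1%N)// (_ : 1`! = 1%N)// invr1 !scale1r.
- exact: qterm_pure_eq0 pa n2.
- by apply: (@qterm_pure_eq0 _ 0); [exact: pure0|apply: leq_trans n2].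
Qed.

(** The coefficients of [a - h (w |- a)]. *)
Definition qcurv w a (n : nat) : ext m R :=
  match n with 0%N => a | 1%N => - bicontr w a | _ => 0 end.

Lemma pure_bicontr w p a : pure p.+2 a -> pure p (bicontr w a).
Proof.
move=> pa; apply: pureZ; apply: pure_sum => i _; apply: pure_sum => j _.
by apply: pureZ; do 2!apply: pure_lcontr.
Qed.

(** Quantum multiplication by [a - h (w |- a)] is the conjugate of the ordinary
    multiplication by the 2-form [a] under [exp (- h w |- _)], an exponential
    series that stops after the second commutator. *)
Lemma qwedge_qcurv w a (b : nat -> ext m R) N : w^T = - w -> pure 2 a ->
  qwedge w (qcurv w a) b N =
    wedge a (b N) - com w (wedge a) (hshift 1 b N)
    + 2^-1 *: com w (com w (wedge a)) (hshift 2 b N).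
Proof.
move=> wA pa; rewrite (@qwedge_trunc _ _ _ _ 3 2) => [|[|[]]//|[|[|p]] n n2 c].
- rewrite !big_ord_recl !big_ord0 /= !addr0.
  rewrite (_ : bump 0 0 = 1%N)// (_ : bump 0 1 = 2%N)//.
  rewrite fact0 (_ : 1`! = 1%N)// (_ : 2`! = 2%N)// invr1 !scale1r.
  rewrite com_com_two_form// com_two_form// !qterm0 hshift0 opprB.
  have pw := pureN (pure_bicontr (w:=w) pa).
  rewrite !(qterm_pure_eq0 _ _ pw)// !addr0 scaler0 addr0.
  by rewrite -scaleN1r wedgeZl scaleN1r !addrA [_ - wedge _ _ + _]addrAC.
- exact: qterm_pure_eq0 pa n2.
- apply: (@qterm_pure_eq0 _ 0); last by apply: leq_trans n2.
  exact/pureN/pure_bicontr.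
- by apply: (@qterm_pure_eq0 _ 0); [exact: pure0|apply: leq_trans n2].
Qed.

End ExteriorAlgebra.
(** * Differential forms on an open subset of R^m *)

(** The partial derivative, locked so that unification never unfolds it. *)
HB.lock Definition pd (R : realType) (m : nat) (k : 'I_m) (f : 'rV[R]_m -> R)
  (x : 'rV[R]_m) : R := 'D_(basisv R k) f x.

#[local] Opaque cinfty.

(** A record, again to keep unification from unfolding it. *)
Record smooth_ext (R : realType) (m : nat) (O : set 'rV[R]_m)
  (a : 'rV[R]_m -> ext m R) : Prop := SmoothExt {
  smooth_extE : forall K, cinfty O (fun x => a x K)
}.

(** Linear identities between forms, checked component by component. *)
Ltac ext_abel :=
  repeat match goal with
  | |- context [wedge ?a ?b] => generalize (wedge a b); intro
  | |- context [sharp ?w ?i ?b] => generalize (sharp w i b); intro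
  | |- context [bicontr ?w ?b] => generalize (bicontr w b); intro
  end; apply/ffunP => ?; rewrite !ffunE; ring.

Section LocalForms.
Variables (R : realType) (m : nat) (O : set 'rV[R]_m).
Hypothesis oO : open O.
Implicit Types (x : 'rV[R]_m) (a b : 'rV[R]_m -> ext m R) (f g : 'rV[R]_m -> R).

Lemma pdE k f : pd k f = fun x => 'D_(basisv R k) f x.
Proof. by rewrite pd.unlock. Qed.

Lemma pd_eq k f g x : O x -> (forall y, O y -> f y = g y) -> pd k f x = pd k g x.
Proof.
move=> Ox fg; rewrite !pdE; apply: near_eq_derive.
by apply: filterS (open_nbhs_nbhs (conj oO Ox)) => y; exact: fg.
Qed.

Lemma cinfty_pd k f : cinfty O f -> cinfty O (pd k f).
Proof. by rewrite pdE; exact: cinftyS. Qed.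

Lemma cinfty_derivable k f x : cinfty O f -> O x -> derivable f x (basisv R k).
Proof. by move=> cf Ox; have [_] := cinfty_at cf Ox; apply. Qed.

Lemma pd_cst k (c : R) x : pd k (fun=> c) x = 0.
Proof. by rewrite pdE; exact: derive_cst. Qed.

Lemma pdD k f g x : cinfty O f -> cinfty O g -> O x ->
  pd k (fun y => f y + g y) x = pd k f x + pd k g x.
Proof. by move=> cf cg Ox; rewrite !pdE; apply: deriveD; exact: cinfty_derivable. Qed.

Lemma pdM k f g x : cinfty O f -> cinfty O g -> O x ->
  pd k (fun y => f y * g y) x = f x * pd k g x + g x * pd k f x.
Proof. by move=> cf cg Ox; rewrite !pdE; apply: deriveM; exact: cinfty_derivable. Qed.

Lemma pd_pd k l f x : cinfty O f -> O x -> pd k (pd l f) x = pd l (pd k f) x.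
Proof. by move=> cf Ox; rewrite !pdE; exact: (schwarz k l oO Ox cf). Qed.

Local Notation smooth_ext := (smooth_ext O).

Definition pdext (k : 'I_m) a x : ext m R := [ffun K => pd k (fun y => a y K) x].

Definition dE a x : ext m R := \sum_k wedge (edx R k) (pdext k a x).

Lemma pdext_eq k a b x : O x -> (forall y, O y -> a y = b y) ->
  pdext k a x = pdext k b x.
Proof.
by move=> Ox ab; apply/ffunP => K; rewrite !ffunE; apply: pd_eq => // y /ab ->.
Qed.

Lemma dE_eq a b x : O x -> (forall y, O y -> a y = b y) -> dE a x = dE b x.
Proof. by move=> Ox ab; apply: eq_bigr => k _; rewrite (pdext_eq k Ox ab). Qed.

Lemma smooth_ext_eq a b : (forall y, O y -> a y = b y) ->
  smooth_ext a -> smooth_ext b.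
Proof.
by move=> ab [sa]; split=> K; apply: (cinfty_eq oO _ (sa K)) => x /ab ->.
Qed.

Lemma smooth_pdext k a : smooth_ext a -> smooth_ext (pdext k a).
Proof.
move=> [sa]; split=> K; apply: (cinfty_eq oO _ (cinfty_pd k (sa K))) => x _.
by rewrite ffunE.
Qed.

Lemma smooth_ext0 : smooth_ext (fun=> 0).
Proof.
by split=> K; apply: (cinfty_eq oO _ (cinfty_cst 0 oO)) => x _; rewrite ffunE.
Qed.

Lemma smooth_extD a b : smooth_ext a -> smooth_ext b ->
  smooth_ext (fun x => a x + b x).
Proof.
move=> [sa] [sb]; split=> K; apply: (cinfty_eq oO _ (cinftyD oO (sa K) (sb K))) => x _.
by rewrite ffunE.
Qed.

Lemma smooth_extZ f a : cinfty O f -> smooth_ext a ->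
  smooth_ext (fun x => f x *: a x).
Proof.
move=> cf [sa]; split=> K; apply: (cinfty_eq oO _ (cinftyM oO cf (sa K))) => x _.
by rewrite ffunE.
Qed.

Lemma smooth_ext_cst (v : ext m R) : smooth_ext (fun=> v).
Proof. by split=> K; exact: cinfty_cst. Qed.

Lemma smooth_ext_sum (I : Type) (r : seq I) (F : I -> 'rV[R]_m -> ext m R) :
  (forall i, smooth_ext (F i)) -> smooth_ext (fun x => \sum_(i <- r) F i x).
Proof.
move=> sF; elim: r => [|i r IH].
  by apply: (smooth_ext_eq _ smooth_ext0) => x _; rewrite big_nil.
apply: (smooth_ext_eq _ (smooth_extD (sF i) IH)) => x _; by rewrite big_cons.
Qed.

Lemma smooth_extN a : smooth_ext a -> smooth_ext (fun x => - a x).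
Proof.
move=> sa; apply: (smooth_ext_eq _ (smooth_extZ (cinfty_cst (-1) oO) sa)) => x _.
by rewrite scaleN1r.
Qed.

Lemma smooth_extB a b : smooth_ext a -> smooth_ext b ->
  smooth_ext (fun x => a x - b x).
Proof. by move=> sa sb; apply: smooth_extD => //; exact: smooth_extN. Qed.

Lemma pdextD k a b x : smooth_ext a -> smooth_ext b -> O x ->
  pdext k (fun y => a y + b y) x = pdext k a x + pdext k b x.
Proof.
move=> [sa] [sb] Ox; apply/ffunP => K; rewrite !ffunE -pdD//.
by apply: pd_eq => // y _; rewrite ffunE.
Qed.

Lemma pdextZ k f a x : cinfty O f -> smooth_ext a -> O x ->
  pdext k (fun y => f y *: a y) x = f x *: pdext k a x + pd k f x *: a x.
Proof.
move=> cf [sa] Ox; apply/ffunP => K; rewrite !ffunE.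
have -> : pd k (fun y => (f y *: a y) K) x = pd k (fun y => f y * a y K) x.
  by apply: pd_eq => // y _; rewrite ffunE.
by rewrite pdM// [a x K * _]mulrC.
Qed.

Lemma pdext_cst k (v : ext m R) x : pdext k (fun=> v) x = 0.
Proof. by apply/ffunP => K; rewrite !ffunE pd_cst. Qed.

Lemma pdext_sum k (I : Type) (r : seq I) (F : I -> 'rV[R]_m -> ext m R) x :
  (forall i, smooth_ext (F i)) -> O x ->
  pdext k (fun y => \sum_(i <- r) F i y) x = \sum_(i <- r) pdext k (F i) x.
Proof.
move=> sF Ox; elim: r => [|i r IH].
  rewrite big_nil -[RHS](pdext_cst k 0 x); apply: pdext_eq => // y _; exact: big_nil.
rewrite big_cons -IH -pdextD//; last exact: smooth_ext_sum.
by apply: pdext_eq => // y _; rewrite big_cons.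
Qed.

Definition delta_ext (K : {set 'I_m}) : ext m R := [ffun J => (J == K)%:R].

Lemma ext_sum_delta (v : ext m R) : v = \sum_K v K *: delta_ext K.
Proof.
apply/ffunP => J; rewrite sum_ffunE (bigD1 J)//= big1 ?addr0.
  by rewrite !ffunE eqxx /GRing.scale /= mulr1.
by move=> K KJ; rewrite !ffunE eq_sym (negbTE KJ) /GRing.scale /= mulr0.
Qed.

(** A linear operator has constant coefficients in the basis [delta_ext], whence its
    compatibility with smoothness and with partial derivatives. *)
Lemma linear_sum_delta (T : {linear ext m R -> ext m R}) (v : ext m R) :
  T v = \sum_K v K *: T (delta_ext K).
Proof.
by rewrite {1}(ext_sum_delta v) linear_sum; apply: eq_bigr => K _; rewrite linearZ.
Qed.

Lemma smooth_linear (T : {linear ext m R -> ext m R}) a :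
  smooth_ext a -> smooth_ext (fun x => T (a x)).
Proof.
move=> sa; apply: (smooth_ext_eq (a := fun x => \sum_K a x K *: T (delta_ext K))).
  by move=> x _; rewrite -linear_sum_delta.
by apply: smooth_ext_sum => K; apply: smooth_extZ; [case: sa|exact: smooth_ext_cst].
Qed.

Lemma pdext_linear k (T : {linear ext m R -> ext m R}) a x : smooth_ext a -> O x ->
  pdext k (fun y => T (a y)) x = T (pdext k a x).
Proof.
move=> sa Ox; rewrite (linear_sum_delta T (pdext k a x)).
have -> : pdext k (fun y => T (a y)) x =
    pdext k (fun y => \sum_K a y K *: T (delta_ext K)) x.
  by apply: pdext_eq => // y _; exact: linear_sum_delta.
rewrite pdext_sum//; last first.
  by move=> K; apply: smooth_extZ; [case: sa|exact: smooth_ext_cst].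
apply: eq_bigr => K _; rewrite pdextZ//; [|by case: sa|exact: smooth_ext_cst].
by rewrite pdext_cst scaler0 add0r ffunE.
Qed.

Lemma wedge_sum_delta (u v : ext m R) :
  wedge u v = \sum_K u K *: wedge (delta_ext K) v.
Proof. exact: (linear_sum_delta (wedgel v)). Qed.

Lemma smooth_wedge a b : smooth_ext a -> smooth_ext b ->
  smooth_ext (fun x => wedge (a x) (b x)).
Proof.
move=> sa sb.
apply: (smooth_ext_eq (a := fun x => \sum_K a x K *: wedge (delta_ext K) (b x))).
  by move=> x _; rewrite -wedge_sum_delta.
by apply: smooth_ext_sum => K; apply: smooth_extZ; [case: sa|exact: smooth_linear].
Qed.

Lemma pdext_wedge k a b x : smooth_ext a -> smooth_ext b -> O x ->
  pdext k (fun y => wedge (a y) (b y)) x =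
    wedge (pdext k a x) (b x) + wedge (a x) (pdext k b x).
Proof.
move=> sa sb Ox.
have -> : pdext k (fun y => wedge (a y) (b y)) x =
    pdext k (fun y => \sum_K a y K *: wedge (delta_ext K) (b y)) x.
  by apply: pdext_eq => // y _; exact: wedge_sum_delta.
rewrite pdext_sum//; last by move=> K; apply: smooth_extZ; [case: sa|exact: smooth_linear].
rewrite [wedge (pdext _ _ _) _]wedge_sum_delta [wedge (a x) _]wedge_sum_delta.
rewrite -big_split; apply: eq_bigr => K _.
rewrite pdextZ//; [|by case: sa|exact: smooth_linear].
by rewrite pdext_linear//= addrC; congr (_ + _); rewrite ffunE.
Qed.

Lemma smooth_dE a : smooth_ext a -> smooth_ext (dE a).
Proof.
move=> sa; apply: smooth_ext_sum => k; apply: smooth_linear; exact: smooth_pdext.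
Qed.

Lemma dED a b x : smooth_ext a -> smooth_ext b -> O x ->
  dE (fun y => a y + b y) x = dE a x + dE b x.
Proof.
move=> sa sb Ox; rewrite /dE -big_split; apply: eq_bigr => k _.
by rewrite pdextD// linearD.
Qed.

Lemma dEN a x : smooth_ext a -> O x -> dE (fun y => - a y) x = - dE a x.
Proof.
move=> sa Ox; rewrite /dE -sumrN; apply: eq_bigr => k _.
by rewrite (pdext_linear k (GRing.opp : {linear ext m R -> ext m R}))// linearN.
Qed.

Lemma dEB a b x : smooth_ext a -> smooth_ext b -> O x ->
  dE (fun y => a y - b y) x = dE a x - dE b x.
Proof. by move=> sa sb Ox; rewrite dED ?dEN//; exact: smooth_extN. Qed.

Lemma dE0 x : dE (fun=> 0) x = 0.
Proof. by apply: big1 => k _; rewrite pdext_cst linear0. Qed.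

Lemma dE_sum (I : Type) (r : seq I) (F : I -> 'rV[R]_m -> ext m R) x :
  (forall i, smooth_ext (F i)) -> O x ->
  dE (fun y => \sum_(i <- r) F i y) x = \sum_(i <- r) dE (F i) x.
Proof.
move=> sF Ox; rewrite /dE exchange_big; apply: eq_bigr => k _.
by rewrite pdext_sum// linear_sum.
Qed.

(** The second derivatives are symmetric and the operators [wedge (edx R k)]
    anticommute. *)
Lemma dE_dE a x : smooth_ext a -> O x -> dE (dE a) x = 0.
Proof.
move=> sa Ox; pose S := \sum_k \sum_l
  wedge (edx R k) (wedge (edx R l) (pdext k (pdext l a) x)).
have E : dE (dE a) x = S.
  apply: eq_bigr => k _; rewrite pdext_sum//; last first.
    by move=> l; apply: smooth_linear; exact: smooth_pdext.
  rewrite linear_sum; apply: eq_bigr => l _; rewrite pdext_linear//.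
  exact: smooth_pdext.
have SN : S = - S.
  rewrite {1}/S exchange_big /S -sumrN; apply: eq_bigr => k _.
  rewrite -sumrN; apply: eq_bigr => l _; rewrite wedge_edx_anti.
  congr (- wedge _ (wedge _ _)); apply/ffunP => K; rewrite !ffunE.
  transitivity (pd l (pd k (fun y => a y K)) x).
    by apply: pd_eq => // y _; rewrite ffunE.
  rewrite pd_pd//; last by case: sa.
  by apply: pd_eq => // y _; rewrite ffunE.
rewrite E (half_double S) {1}SN addNr scaler0; reflexivity.
Qed.

Lemma wedge_edx_one_form k (u v : ext m R) : pure 1 u ->
  wedge (edx R k) (wedge u v) = - wedge u (wedge (edx R k) v).
Proof.
move=> pu; rewrite !(wedge_one_form _ pu) linear_sum -sumrN; apply: eq_bigr => i _.
by rewrite linearZ /= wedge_edx_anti scalerN.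
Qed.

Lemma wedge_one_formA (u v z : ext m R) : pure 1 u ->
  wedge (wedge u v) z = wedge u (wedge v z).
Proof.
move=> pu; rewrite !(wedge_one_form _ pu) wedge_suml; apply: eq_bigr => i _.
by rewrite wedgeZl wedge_edxA.
Qed.

Lemma dE_wedge_one_form a b x : smooth_ext a -> smooth_ext b ->
  (forall y, O y -> pure 1 (a y)) -> O x ->
  dE (fun y => wedge (a y) (b y)) x = wedge (dE a x) (b x) - wedge (a x) (dE b x).
Proof.
move=> sa sb pa Ox; rewrite /dE wedge_suml wedge_sumr -sumrB.
apply: eq_bigr => k _; rewrite pdext_wedge// linearD /= wedge_edxA.
by rewrite (wedge_edx_one_form _ _ (pa x Ox)).
Qed.

Definition dfun f x : ext m R := \sum_k pd k f x *: edx R k.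

Lemma dE_ext1 f x : cinfty O f -> O x -> dE (fun y => f y *: ext1 R m) x = dfun f x.
Proof.
move=> cf Ox; apply: eq_bigr => k _; rewrite pdextZ//; last exact: smooth_ext_cst.
by rewrite pdext_cst scaler0 add0r linearZ /= wedge_edx_ext1.
Qed.

Lemma dEZ f a x : cinfty O f -> smooth_ext a -> O x ->
  dE (fun y => f y *: a y) x = wedge (dfun f x) (a x) + f x *: dE a x.
Proof.
move=> cf sa Ox; rewrite /dE /dfun wedge_suml scaler_sumr -big_split.
apply: eq_bigr => k _; rewrite pdextZ// linearD /= addrC !linearZ /=.
by rewrite wedgeZl.
Qed.

Lemma pure_pdext p k a x : (forall y, O y -> pure p (a y)) -> O x ->
  pure p (pdext k a x).
Proof.
move=> pa Ox; apply: pureP => K Kp; rewrite ffunE -[RHS](pd_cst k 0 x).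
by apply: pd_eq => // y /pa py; rewrite (pure_eq0 py).
Qed.

Lemma pure_dE p a x : (forall y, O y -> pure p (a y)) -> O x -> pure p.+1 (dE a x).
Proof.
by move=> pa Ox; apply: pure_sum => k _; apply: pure_wedge_edx; exact: pure_pdext.
Qed.

Lemma pure_wedge11 (u v : ext m R) : pure 1 u -> pure 1 v -> pure 2 (wedge u v).
Proof.
move=> pu pv; rewrite (wedge_one_form _ pu); apply: pure_sum => i _.
by apply: pureZ; exact: pure_wedge_edx.
Qed.

(** ** Contraction with a Poisson bivector *)

Variable w : 'rV[R]_m -> 'M[R]_m.
Hypothesis w_smooth : forall i j, cinfty O (fun x => w x i j).
Hypothesis w_anti : forall x, O x -> (w x)^T = - w x.
Hypothesis w_jacobi : forall x, O x -> forall i j l,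
  \sum_k (w x i k * pd k (fun y => w y j l) x + w x j k * pd k (fun y => w y l i) x
    + w x l k * pd k (fun y => w y i j) x) = 0.

Definition iota a x : ext m R := bicontr (w x) (a x).

Definition pdw k x : 'M[R]_m := \matrix_(i, j) pd k (fun y => w y i j) x.

Lemma smooth_iota a : smooth_ext a -> smooth_ext (iota a).
Proof.
move=> sa; apply: smooth_extZ; first exact: cinfty_cst.
apply: smooth_ext_sum => k; apply: smooth_ext_sum => l; apply: smooth_extZ => //.
apply: (@smooth_linear (@lcontr R m k) (fun x => lcontr l (a x))).
exact: (@smooth_linear (@lcontr R m l)).
Qed.

Lemma pdext_iota k a x : smooth_ext a -> O x ->
  pdext k (iota a) x = bicontr (pdw k x) (a x) + bicontr (w x) (pdext k a x).
Proof.
move=> sa Ox; rewrite /iota /bicontr.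
have sl l : smooth_ext (fun x => lcontr l (a x)) by exact: smooth_linear.
have sll i l : smooth_ext (fun x => lcontr i (lcontr l (a x))).
  exact: (@smooth_linear (@lcontr R m i) (fun x => lcontr l (a x))).
have swl i l : smooth_ext (fun x => w x i l *: lcontr i (lcontr l (a x))).
  exact: smooth_extZ.
rewrite pdextZ; [|exact: cinfty_cst| |exact: Ox]; last first.
  by apply: smooth_ext_sum => i; apply: smooth_ext_sum.
rewrite pd_cst scale0r addr0 -scalerDr; congr (_ *: _).
rewrite pdext_sum//; last by move=> i; apply: smooth_ext_sum.
rewrite -big_split; apply: eq_bigr => i _.
rewrite pdext_sum// -big_split; apply: eq_bigr => l _.
rewrite pdextZ// addrC mxE; congr (_ + _ *: _).
rewrite (@pdext_linear k (@lcontr R m i) (fun x => lcontr l (a x)))//.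
by rewrite /= (@pdext_linear k (@lcontr R m l)).
Qed.

(** The Koszul operator [delta], as the commutator of the contraction with [w] and
    the exterior derivative. *)
Definition koszulE a x : ext m R := iota (dE a) x - dE (iota a) x.

Lemma koszulE_formula a x : smooth_ext a -> O x ->
  koszulE a x = - \sum_k (sharp (w x) k (pdext k a x)
                          + wedge (edx R k) (bicontr (pdw k x) (a x))).
Proof.
move=> sa Ox; rewrite /koszulE /iota /dE bicontr_sum -sumrB -sumrN.
apply: eq_bigr => k _; rewrite pdext_iota// linearD /= bicontr_edx; last exact: w_anti.
by ext_abel.
Qed.

Lemma bicontr_bicontr (w1 w2 : 'M[R]_m) (v : ext m R) :
  bicontr w1 (bicontr w2 v) = bicontr w2 (bicontr w1 v).
Proof.
have -> : bicontr w1 (bicontr w2 v) =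
    bicontr w1 (2^-1 *: \sum_k \sum_l w2 k l *: lcontr k (lcontr l v)) by [].
rewrite bicontrZ [RHS]/bicontr; congr (_ *: _); rewrite bicontr_sum.
apply: eq_bigr => k _; rewrite bicontr_sum; apply: eq_bigr => l _.
by rewrite bicontrZ !bicontr_lcontr.
Qed.

Lemma sum3_cyclic (V : nmodType) (G : 'I_m -> 'I_m -> 'I_m -> V) :
  \sum_i \sum_j \sum_l G i j l = \sum_i \sum_j \sum_l G j l i.
Proof.
rewrite [RHS]exchange_big; apply: eq_bigr => i _.
by rewrite exchange_big.
Qed.

(** The components of the Schouten bracket of [w] with itself are cyclic sums
    that the Jacobi identity makes vanish, and three contractions are cyclically
    symmetric. *)
Lemma sharp_pdw (v : ext m R) x : O x ->
  \sum_k sharp (w x) k (bicontr (pdw k x) v) = 0.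
Proof.
move=> Ox.
pose A (l p q : 'I_m) := \sum_k w x k l * pd k (fun y => w y p q) x.
pose T (l p q : 'I_m) : ext m R := lcontr l (lcontr p (lcontr q v)).
have TC l p q : T l p q = T p q l.
  by rewrite /T (lcontr_anti l p) (lcontr_anti l q) [lcontr p (- _)]linearN /= opprK.
have AC l p q : A l p q + A p q l + A q l p = 0.
  rewrite /A -!big_split /=; apply/eqP; rewrite -oppr_eq0 -sumrN; apply/eqP.
  apply: etrans (w_jacobi Ox l p q); apply: eq_bigr => k _.
  rewrite (antisymE k l (w_anti Ox)) (antisymE k p (w_anti Ox)).
  by rewrite (antisymE k q (w_anti Ox)); ring.
pose S := \sum_l \sum_p \sum_q A l p q *: T l p q.
have -> : \sum_k sharp (w x) k (bicontr (pdw k x) v) = 2^-1 *: S.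
  transitivity (\sum_k \sum_l \sum_p \sum_q
      (2^-1 * (w x k l * pd k (fun y => w y p q) x)) *: T l p q).
    apply: eq_bigr => k _; apply: eq_bigr => l _.
    rewrite /bicontr lcontrZ lcontr_sum scalerA scaler_sumr; apply: eq_bigr => p _.
    rewrite lcontr_sum scaler_sumr; apply: eq_bigr => q _.
    by rewrite lcontrZ scalerA mxE; congr (_ *: _); ring.
  rewrite exchange_big scaler_sumr; apply: eq_bigr => l _.
  rewrite exchange_big scaler_sumr; apply: eq_bigr => p _.
  rewrite exchange_big scaler_sumr; apply: eq_bigr => q _.
  by rewrite -scaler_suml -mulr_sumr scalerA.
have S2 : S = \sum_l \sum_p \sum_q A p q l *: T l p q.
  rewrite /S sum3_cyclic; apply: eq_bigr => l _; apply: eq_bigr => p _.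
  by apply: eq_bigr => q _; rewrite (TC l p q).
have S3 : S = \sum_l \sum_p \sum_q A q l p *: T l p q.
  rewrite S2 sum3_cyclic; apply: eq_bigr => l _; apply: eq_bigr => p _.
  by apply: eq_bigr => q _; rewrite (TC l p q).
have S0 : S + S + S = 0.
  rewrite {2}S2 {2}S3 /S -!big_split /=; apply: big1 => l _.
  rewrite -!big_split /=; apply: big1 => p _.
  rewrite -!big_split /=; apply: big1 => q _.
  by rewrite -!scalerDl AC scale0r.
apply/ffunP => K; move/ffunP: S0 => /(_ K); rewrite !ffunE => S0.
have -> : S K = 0 by lra.
exact: scaler0.
Qed.

(** The contraction with [w] commutes with its commutator with [dE]: the difference
    is twice the sum that [sharp_pdw] makes vanish. *)
Lemma iota_koszulE a x : smooth_ext a -> O x ->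
  iota (koszulE a) x = koszulE (iota a) x.
Proof.
move=> sa Ox; rewrite {1}/iota !koszulE_formula//; last exact: smooth_iota.
rewrite [bicontr _ (- _)]linearN /= bicontr_sum; congr (- _); apply/eqP.
rewrite -subr_eq0 -sumrB -oppr_eq0 -sumrN.
rewrite (eq_bigr (fun k => sharp (w x) k (bicontr (pdw k x) (a x)) +
    sharp (w x) k (bicontr (pdw k x) (a x)))); last first.
  move=> k _; rewrite pdext_iota// [bicontr _ (_ + _)]linearD /= bicontr_sharp.
  rewrite bicontr_edx; last exact: w_anti.
  rewrite [sharp _ _ (_ + _)]linearD /= /iota (bicontr_bicontr (w x)).
  by ext_abel.
by rewrite big_split /= sharp_pdw// addr0.
Qed.

(** ** Covariant derivatives on vectors of forms *)

Variable r : nat.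
Implicit Types (t F : 'I_r -> 'I_r -> 'rV[R]_m -> ext m R)
  (u v : 'I_r -> 'rV[R]_m -> ext m R).

Definition smooth_vec u := forall k, smooth_ext (u k).

Definition Dcov t u k x : ext m R := \sum_j wedge (t j k x) (u j x) + dE (u k) x.

Definition viota u k x : ext m R := iota (u k) x.

Definition vcom (P : ('I_r -> 'rV[R]_m -> ext m R) -> 'I_r -> 'rV[R]_m -> ext m R)
  u k x : ext m R := bicontr (w x) (P u k x) - P (viota u) k x.

Definition connection_on t :=
  (forall j k, smooth_ext (t j k)) /\ forall j k x, O x -> pure 1 (t j k x).

Definition curv t i k x : ext m R :=
  dE (t i k) x + \sum_j wedge (t j k x) (t i j x).

Lemma smooth_viota u : smooth_vec u -> smooth_vec (viota u).
Proof. by move=> su k; exact: smooth_iota. Qed.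

Lemma smooth_vecB u v : smooth_vec u -> smooth_vec v ->
  smooth_vec (fun k x => u k x - v k x).
Proof. by move=> su sv k; exact: smooth_extB. Qed.

Lemma smooth_Dcov t u : connection_on t -> smooth_vec u -> smooth_vec (Dcov t u).
Proof.
move=> [st _] su k; apply: smooth_extD; last exact: smooth_dE.
by apply: smooth_ext_sum => j; exact: smooth_wedge.
Qed.

Lemma smooth_vcom t u : connection_on t -> smooth_vec u ->
  smooth_vec (vcom (Dcov t) u).
Proof.
move=> ct su; apply: smooth_vecB.
  by apply: smooth_viota; exact: smooth_Dcov.
by apply: smooth_Dcov => //; exact: smooth_viota.
Qed.

Lemma Dcov_eq t u v k x : O x -> (forall k y, O y -> u k y = v k y) ->
  Dcov t u k x = Dcov t v k x.
Proof.
move=> Ox uv; congr (_ + _); last by apply: dE_eq => // y; exact: uv.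
by apply: eq_bigr => j _; rewrite uv.
Qed.

Lemma vcom_eq t u v k x : O x -> (forall k y, O y -> u k y = v k y) ->
  vcom (Dcov t) u k x = vcom (Dcov t) v k x.
Proof.
move=> Ox uv; rewrite /vcom (Dcov_eq t k Ox uv); congr (_ - _).
by apply: Dcov_eq => // j y Oy; rewrite /viota /iota uv.
Qed.

Lemma Dcov0 t k x : Dcov t (fun _ _ => 0) k x = 0.
Proof.
by rewrite /Dcov dE0 addr0; apply: big1 => j _; exact: linear0.
Qed.

Lemma vcom0 t k x : O x -> vcom (Dcov t) (fun _ _ => 0) k x = 0.
Proof.
move=> Ox; rewrite /vcom Dcov0 [bicontr _ _]linear0 sub0r.
rewrite (@Dcov_eq t _ (fun _ _ => 0))// ?Dcov0 ?oppr0// => j y _.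
exact: linear0.
Qed.

Lemma smooth_curv t i k : connection_on t -> smooth_ext (curv t i k).
Proof.
move=> [st _]; apply: smooth_extD; first exact: smooth_dE.
by apply: smooth_ext_sum => j; exact: smooth_wedge.
Qed.

Lemma DcovB t u v k x : smooth_vec u -> smooth_vec v -> O x ->
  Dcov t (fun k y => u k y - v k y) k x = Dcov t u k x - Dcov t v k x.
Proof.
move=> su sv Ox; rewrite /Dcov dEB// opprD addrACA; congr (_ + _).
by rewrite -sumrB; apply: eq_bigr => j _; rewrite linearB.
Qed.

Lemma viotaB u v k x : viota (fun k y => u k y - v k y) k x = viota u k x - viota v k x.
Proof. exact: linearB. Qed.

(** The derivatives of [u] cancel because [dE] anticommutes with a 1-form up to the
    derivative of the form. *)
Lemma Dcov_Dcov t u k x : connection_on t -> smooth_vec u -> O x ->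
  Dcov t (Dcov t u) k x = \sum_i wedge (curv t i k x) (u i x).
Proof.
move=> [st pt] su Ox; rewrite {1}/Dcov.
have sw i j : smooth_ext (fun x => wedge (t i j x) (u i x)) by exact: smooth_wedge.
have -> : dE (Dcov t u k) x =
    \sum_i (wedge (dE (t i k) x) (u i x) - wedge (t i k x) (dE (u i) x)).
  rewrite dED//; [|by apply: smooth_ext_sum => i|exact: smooth_dE].
  rewrite dE_dE// addr0 dE_sum//; apply: eq_bigr => i _.
  by rewrite dE_wedge_one_form// => y; exact: pt.
have -> : \sum_j wedge (t j k x) (Dcov t u j x) =
    \sum_i (\sum_j wedge (wedge (t j k x) (t i j x)) (u i x)) +
    \sum_i wedge (t i k x) (dE (u i) x).
  rewrite [X in X + _]exchange_big -big_split; apply: eq_bigr => j _.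
  rewrite wedgeDr wedge_sumr; congr (_ + _); apply: eq_bigr => i _.
  by rewrite wedge_one_formA//; exact: pt.
rewrite -big_split -big_split; apply: eq_bigr => i _ /=.
rewrite /curv wedgeDl wedge_suml.
move: (\sum_j _) (wedge (t i k x) _) (wedge _ (u i x)) => X Y Z.
by apply/ffunP => K; rewrite !ffunE; ring.
Qed.

Lemma pure_curv t i k x : connection_on t -> O x -> pure 2 (curv t i k x).
Proof.
move=> [st pt] Ox; apply: pureD.
  by apply: pure_dE => // y; exact: pt.
by apply: pure_sum => j _; apply: pure_wedge11; exact: pt.
Qed.

Lemma vcom_formula t u k x :
  vcom (Dcov t) u k x =
    \sum_j com (w x) (wedge (t j k x)) (u j x) + koszulE (u k) x.
Proof.
rewrite /vcom /Dcov [bicontr _ (_ + _)]linearD /= bicontr_sum opprD addrACA -sumrB.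
by [].
Qed.

Lemma iota_vcom t u k x : connection_on t -> smooth_vec u -> O x ->
  bicontr (w x) (vcom (Dcov t) u k x) = vcom (Dcov t) (viota u) k x.
Proof.
move=> [st pt] su Ox; rewrite !vcom_formula [bicontr _ (_ + _)]linearD /=.
congr (_ + _); last exact: iota_koszulE.
rewrite bicontr_sum; apply: eq_bigr => j _.
have wA := w_anti Ox; have pj := pt j k x Ox.
rewrite !com_one_form// !qterm1_one_form// [bicontr _ (- _)]linearN /= bicontr_sum.
by congr (- _); apply: eq_bigr => i _; rewrite bicontrZ bicontr_sharp.
Qed.

(** With [D] the covariant derivative and [i] the contraction with [w], the square
    of [D - h [i, D]] is [D^2 - h [i, D^2] + h^2/2 [i, [i, D^2]]]: the last term
    comes from [[i, D]^2] by the vanishing of [[i, [i, D]]]. *)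
Lemma quantum_square t (u0 u1 u2 : 'I_r -> 'rV[R]_m -> ext m R) k x :
  connection_on t -> smooth_vec u0 -> smooth_vec u1 -> smooth_vec u2 -> O x ->
  Dcov t (fun k y => Dcov t u0 k y - vcom (Dcov t) u1 k y) k x -
  vcom (Dcov t) (fun k y => Dcov t u1 k y - vcom (Dcov t) u2 k y) k x =
  \sum_i (wedge (curv t i k x) (u0 i x) - com (w x) (wedge (curv t i k x)) (u1 i x)
    + 2^-1 *: com (w x) (com (w x) (wedge (curv t i k x))) (u2 i x)).
Proof.
move=> ct s0 s1 s2 Ox; set P := Dcov t.
have sP u : smooth_vec u -> smooth_vec (P u) by exact: smooth_Dcov.
have sC u : smooth_vec u -> smooth_vec (vcom P u) by exact: smooth_vcom.
have sI u : smooth_vec u -> smooth_vec (viota u) by exact: smooth_viota.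
have PP u : smooth_vec u -> P (P u) k x = \sum_i wedge (curv t i k x) (u i x).
  by move=> su; exact: Dcov_Dcov.
have E1 : viota (P (P u1)) k x - P (P (viota u1)) k x =
    \sum_i com (w x) (wedge (curv t i k x)) (u1 i x).
  rewrite /viota /iota -/(viota _) !PP//; last exact: sI.
  by rewrite bicontr_sum -sumrB.
have E2 : viota (viota (P (P u2))) k x - viota (P (P (viota u2))) k x
    - viota (P (P (viota u2))) k x + P (P (viota (viota u2))) k x =
    \sum_i com (w x) (com (w x) (wedge (curv t i k x))) (u2 i x).
  have -> : viota (viota (P (P u2))) k x =
    bicontr (w x) (bicontr (w x) (P (P u2) k x)) by [].
  have -> : viota (P (P (viota u2))) k x = bicontr (w x) (P (P (viota u2)) k x) by [].
  rewrite !PP//; [|exact/sI/sI|exact: sI].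
  rewrite !bicontr_sum -!sumrB -big_split; apply: eq_bigr => i _ /=.
  rewrite /com bicontrB /viota /iota; by ext_abel.
have PB u v : smooth_vec u -> smooth_vec v ->
    P (fun k y => u k y - v k y) k x = P u k x - P v k x.
  by move=> su sv; exact: DcovB.
have PE u v : (forall k y, O y -> u k y = v k y) -> P u k x = P v k x.
  by move=> uv; exact: Dcov_eq.
have IB u v : P (viota (fun k y => u k y - v k y)) k x =
    P (fun k y => viota u k y - viota v k y) k x.
  by apply: PE => i y _; exact: viotaB.
have PC u : smooth_vec u ->
    P (vcom P u) k x = P (viota (P u)) k x - P (P (viota u)) k x.
  by move=> su; apply: PB; [exact/sI/sP|exact/sP/sI].
have VE u : vcom P u k x = bicontr (w x) (P u k x) - P (viota u) k x by [].
have F1 : P (viota (vcom P u2)) k x =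
    P (viota (P (viota u2))) k x - P (P (viota (viota u2))) k x.
  rewrite -PC; last exact: sI.
  by apply: PE => i y Oy; exact: iota_vcom.
have F2 : P (viota (vcom P u2)) k x =
    P (viota (viota (P u2))) k x - P (viota (P (viota u2))) k x.
  by rewrite IB PB//; [exact/sI/sI/sP|exact/sI/sP/sI].
have F3 : viota (viota (P (P u2))) k x - viota (P (viota (P u2))) k x =
    viota (P (viota (P u2))) k x - P (viota (viota (P u2))) k x.
  have := iota_vcom k ct (sP _ s2) Ox.
  by rewrite /vcom bicontrB.
have G1 : P (fun k y => P u0 k y - vcom P u1 k y) k x =
    P (P u0) k x - (P (viota (P u1)) k x - P (P (viota u1)) k x).
  by rewrite PB ?PC//; [exact: sP|exact: sC].
have G2 : vcom P (fun k y => P u1 k y - vcom P u2 k y) k x =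
    viota (P (P u1)) k x
    - (viota (P (viota (P u2))) k x - viota (P (P (viota u2))) k x)
    - (P (viota (P u1)) k x - P (viota (vcom P u2)) k x).
  rewrite VE IB (PB (P u1)); [|exact: sP|exact: sC].
  rewrite (PB (viota (P u1))); [|exact/sI/sP|exact/sI/sC].
  by rewrite bicontrB (PC u2 s2) bicontrB.
rewrite !big_split /= sumrN -scaler_sumr -(PP u0 s0) -E1 -E2 G1 G2.
move: F1 F2 F3.
move: (P (P u0) k x) (P (viota (P u1)) k x) (P (P (viota u1)) k x)
  (viota (P (P u1)) k x) (viota (P (viota (P u2))) k x)
  (viota (P (P (viota u2))) k x) (P (viota (vcom P u2)) k x)
  (viota (viota (P (P u2))) k x) (P (P (viota (viota u2))) k x)
  (P (viota (P (viota u2))) k x) (P (viota (viota (P u2))) k x).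
move=> a1 a2 a3 a4 a5 a6 a7 a8 a9 a10 a11 F1 F2 F3; apply/ffunP => K.
move/ffunP: F1 => /(_ K); move/ffunP: F2 => /(_ K); move/ffunP: F3 => /(_ K).
rewrite !ffunE /GRing.scale /= => F3 F2 F1; lra.
Qed.

(** ** Change of frame *)

Definition gauge (gg : 'I_r -> 'I_r -> 'rV[R]_m -> R) u k x : ext m R :=
  \sum_j gg j k x *: u j x.

(** The connection matrices [t] and [t'] of one connection, [gg] being the matrix
    of the old frame in the new one. *)
Definition gauge_related (gg : 'I_r -> 'I_r -> 'rV[R]_m -> R) t t' :=
  forall j k x, O x ->
    dfun (gg j k) x + \sum_l gg j l x *: t' l k x = \sum_l gg l k x *: t j l x.

Lemma smooth_gauge gg u : (forall j k, cinfty O (gg j k)) -> smooth_vec u ->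
  smooth_vec (gauge gg u).
Proof. by move=> cg su k; apply: smooth_ext_sum => j; exact: smooth_extZ. Qed.

Lemma Dcov_gauge gg t t' u k x : (forall j k, cinfty O (gg j k)) ->
  gauge_related gg t t' -> smooth_vec u -> O x ->
  Dcov t' (gauge gg u) k x = gauge gg (Dcov t u) k x.
Proof.
move=> cg rel su Ox; rewrite {1}/Dcov.
have -> : dE (gauge gg u k) x =
    \sum_j wedge (dfun (gg j k) x) (u j x) + \sum_j gg j k x *: dE (u j) x.
  rewrite dE_sum => [|j|//]; last exact: smooth_extZ.
  by rewrite -big_split; apply: eq_bigr => j _; rewrite dEZ.
have -> : \sum_j wedge (t' j k x) (gauge gg u j x) =
    \sum_j wedge (\sum_l gg j l x *: t' l k x) (u j x).
  rewrite [RHS](eq_bigr (fun j => \sum_l wedge (gg j l x *: t' l k x) (u j x))); last first.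
    by move=> j _; rewrite wedge_suml.
  rewrite exchange_big; apply: eq_bigr => l _; rewrite wedge_sumr.
  by apply: eq_bigr => j _; rewrite wedgeZl wedgeZr.
rewrite addrA -big_split /=.
rewrite (eq_bigr (fun j => \sum_l gg l k x *: wedge (t j l x) (u j x))); last first.
  move=> j _; rewrite -wedgeDl addrC rel// wedge_suml; apply: eq_bigr => l _.
  by rewrite wedgeZl.
rewrite exchange_big -big_split; apply: eq_bigr => l _ /=.
rewrite /Dcov [RHS]scalerDr; congr (_ + _).
by rewrite [RHS]scaler_sumr.
Qed.

Lemma viota_gauge gg u k x : viota (gauge gg u) k x = gauge gg (viota u) k x.
Proof. by rewrite /viota /iota bicontr_sum; apply: eq_bigr => j _; rewrite bicontrZ. Qed.

Lemma vcom_gauge gg t t' u k x : (forall j k, cinfty O (gg j k)) ->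
  gauge_related gg t t' -> smooth_vec u -> O x ->
  vcom (Dcov t') (gauge gg u) k x = gauge gg (vcom (Dcov t) u) k x.
Proof.
move=> cg rel su Ox; rewrite /vcom (Dcov_gauge k cg rel su Ox).
rewrite (@Dcov_eq t' (viota (gauge gg u)) (gauge gg (viota u)))//; last first.
  by move=> j y _; exact: viota_gauge.
rewrite (Dcov_gauge k cg rel (smooth_viota su) Ox).
rewrite -[bicontr _ _]/(viota (gauge gg (Dcov t u)) k x) viota_gauge.
by rewrite /gauge -sumrB; apply: eq_bigr => j _; rewrite -scalerBr.
Qed.

(** Both sides are components of the square of the covariant derivative, applied to
    the [j]-th vector of the old frame. *)
Lemma curv_gauge gg t t' j k x : (forall j k, cinfty O (gg j k)) ->
  connection_on t -> connection_on t' -> gauge_related gg t t' -> O x ->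
  \sum_l gg j l x *: curv t' l k x = \sum_l gg l k x *: curv t j l x.
Proof.
move=> cg ct ct' rel Ox.
pose u (i : 'I_r) (y : 'rV[R]_m) : ext m R := (i == j)%:R *: ext1 R m.
have su : smooth_vec u by move=> i; exact: smooth_ext_cst.
have E : Dcov t' (Dcov t' (gauge gg u)) k x = gauge gg (Dcov t (Dcov t u)) k x.
  rewrite (@Dcov_eq t' _ (gauge gg (Dcov t u)))//; last first.
    by move=> i y Oy; exact: Dcov_gauge.
  by apply: Dcov_gauge => //; exact: smooth_Dcov.
have Eu i y : gauge gg u i y = gg j i y *: ext1 R m.
  rewrite /gauge /u (bigD1 j)//= eqxx scale1r big1 ?addr0// => l /negbTE ->.
  by rewrite scale0r scaler0.
move: E; rewrite Dcov_Dcov//; last exact: smooth_gauge.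
under eq_bigr do rewrite Eu wedgeZr wedge_ext1r.
move=> ->; apply: eq_bigr => l _; rewrite Dcov_Dcov//; congr (_ *: _).
rewrite (bigD1 j)//= /u eqxx scale1r wedge_ext1r big1 ?addr0// => i /negbTE ->.
by rewrite scale0r linear0.
Qed.

End LocalForms.
(** * Pullback of forms of low degree *)

Section Pullback.
Variables (R : realType) (m : nat).
Implicit Types (A : 'M[R]_m) (a b u v : ext m R).

Definition pullcol A (i : 'I_m) : ext m R := \sum_k A k i *: edx R k.

Lemma epull_is_linear A : linear (epull A : ext m R -> ext m R).
Proof.
move=> c u v; rewrite /epull scaler_sumr -big_split; apply: eq_bigr => I _.
by rewrite !ffunE scalerDl scalerA.
Qed.
HB.instance Definition _ A :=
  GRing.isLinear.Build R (ext m R) (ext m R) _ (epull A) (epull_is_linear A).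

Lemma epullZ A (c : R) u : epull A (c *: u) = c *: epull A u.
Proof. exact: linearZ. Qed.
Lemma epull_sum A (T : finType) (F : T -> ext m R) :
  epull A (\sum_x F x) = \sum_x epull A (F x).
Proof. exact: linear_sum. Qed.

Lemma epull_delta A K :
  epull A (delta_ext R K) = \big[@wedge R m/ext1 R m]_(i <- enum K) pullcol A i.
Proof.
rewrite /epull (bigD1 K)//= big1 ?addr0; first by rewrite ffunE eqxx scale1r.
by move=> I /negbTE IK; rewrite ffunE IK scale0r.
Qed.

Lemma epull_ext1 A : epull A (ext1 R m) = ext1 R m.
Proof.
have -> : ext1 R m = delta_ext R finset.set0 by apply/ffunP => K; rewrite !ffunE.
rewrite epull_delta (_ : enum _ = [::]) ?big_nil; last by rewrite enum_set0.
by apply/ffunP => K; rewrite !ffunE.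
Qed.

Lemma epull_edx A i : epull A (edx R i) = pullcol A i.
Proof.
have -> : edx R i = delta_ext R [set i]%SET by apply/ffunP => K; rewrite !ffunE.
by rewrite epull_delta enum_set1 big_cons big_nil wedge_ext1r.
Qed.

Lemma pure_edx i : pure 1 (edx R i : ext m R).
Proof.
apply: pureP => K K1; rewrite ffunE.
by have [E|//] := eqVneq K [set i]%SET; rewrite E cards1 eqxx in K1.
Qed.

Lemma pure_pullcol A i : pure 1 (pullcol A i).
Proof. by apply: pure_sum => k _; apply: pureZ; exact: pure_edx. Qed.

Lemma wedge_pure1C u v : pure 1 u -> pure 1 v -> wedge u v = - wedge v u.
Proof.
move=> pu pv; rewrite {1}(one_form pv) (wedge_one_form _ pv) linear_sum -sumrN.
apply: eq_bigr => i _; rewrite linearZ /= -scalerN -{1}wedge_edx_ext1; congr (_ *: _).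
apply: (canRL opprK); rewrite -wedge_edx_one_form//.
by rewrite wedge_ext1r.
Qed.

Lemma wedge_pure1_diag u : pure 1 u -> wedge u u = 0.
Proof.
move=> pu; rewrite (half_double (wedge u u)) {1}wedge_pure1C// addNr.
exact: scaler0.
Qed.

Lemma enum_set2 (i j : 'I_m) : (i < j)%N -> enum [set i; j]%SET = [:: i; j].
Proof.
move=> ij; apply: (@irr_sorted_eq _ (fun i j : 'I_m => (i < j)%N)).
- by move=> x y z; exact: ltn_trans.
- by move=> x; exact: ltnn.
- apply: sorted_filter; first by move=> x y z; exact: ltn_trans.
  have := iota_ltn_sorted 0 m; rewrite -val_enum_ord sorted_map.
  by rewrite enumT.
- by rewrite /= ij.
- by move=> x; rewrite mem_enum !inE.
Qed.

Lemma edx2_delta (i j : 'I_m) : (i < j)%N ->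
  wedge (edx R i) (edx R j) = delta_ext R [set i; j]%SET.
Proof.
move=> ij; apply/ffunP => K; rewrite wedge_edxE !ffunE.
have inj : i != j by apply: contraTneq ij => ->; rewrite ltnn.
case: ifP => iK; last first.
  by case: eqVneq => // E; rewrite E !inE eqxx in iK.
have -> : ((K :\ i)%SET == [set j]%SET) = (K == [set i; j]%SET).
  apply/eqP/eqP => [E|->]; first by rewrite -(finset.setD1K iK) E.
  apply/setP => x; rewrite !inE; case: (eqVneq x i) => //= ->.
  by rewrite (negbTE inj).
case: eqVneq => [->|]; rewrite ?mulr0// mulr1 /ksign.
rewrite (_ : [set _ in _ | _]%SET = finset.set0) ?cards0//.
apply/setP => x; rewrite !inE; apply/negbTE; rewrite negb_and.
case: (eqVneq x i) => [->|xi] /=; first by rewrite ltnn.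
by case: (eqVneq x j) => //= ->; rewrite -leqNgt ltnW.
Qed.

(** Both sides are alternating in [i] and [j], and for [i < j] the product defining
    [epull] is taken in this order. *)
Lemma epull_edx2 A i j :
  epull A (wedge (edx R i) (edx R j)) = wedge (pullcol A i) (pullcol A j).
Proof.
wlog ij : i j / (i < j)%N => [H|].
  case: (ltngtP i j) => [ij|ij|/val_inj ->]; first exact: H.
    rewrite (wedge_pure1C (@pure_edx i) (@pure_edx j)) linearN /= H//.
    by rewrite -wedge_pure1C//; exact: pure_pullcol.
  rewrite !wedge_pure1_diag ?linear0//; [exact: pure_pullcol|exact: pure_edx].
rewrite edx2_delta// epull_delta enum_set2// !big_cons big_nil.
by rewrite wedge_ext1r.
Qed.

Lemma epull_one_form A a : pure 1 a ->
  epull A a = \sum_i a [set i]%SET *: pullcol A i.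
Proof.
move=> pa; rewrite {1}(one_form pa) linear_sum; apply: eq_bigr => i _.
by rewrite linearZ /= epull_edx.
Qed.

Lemma epull_wedge11 A u v : pure 1 u -> pure 1 v ->
  epull A (wedge u v) = wedge (epull A u) (epull A v).
Proof.
move=> pu pv; rewrite [in LHS](one_form pv) (wedge_one_form _ pu) epull_sum.
rewrite (epull_one_form A pu) wedge_suml; apply: eq_bigr => i _.
rewrite epullZ wedge_sumr epull_sum wedgeZl; congr (_ *: _).
rewrite (epull_one_form A pv) wedge_sumr; apply: eq_bigr => j _.
by rewrite !wedgeZr epullZ epull_edx2.
Qed.

Lemma bicontr_edx2 (w : 'M[R]_m) i j : w^T = - w ->
  bicontr w (wedge (edx R i) (edx R j)) = - w i j *: ext1 R m.
Proof.
move=> wA; rewrite bicontr_edx//.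
have -> : bicontr w (edx R j) = 0.
  rewrite /bicontr big1 ?scaler0// => k _; apply: big1 => l _.
  by rewrite lcontr_edx lcontrZ lcontr_ext1 !scaler0.
rewrite linear0 add0r /sharp (bigD1 j)//= lcontr_edx eqxx scale1r big1 ?addr0.
  by rewrite scaleNr.
by move=> l /negbTE lj; rewrite lcontr_edx lj scale0r scaler0.
Qed.

(** By linearity it is enough to compare both sides on [dx^i /\ dx^j]. *)
Lemma bicontr_epull A (w : 'M[R]_m) a : w^T = - w -> pure 2 a ->
  bicontr w (epull A a) = epull A (bicontr (A^T *m w *m A) a).
Proof.
move=> wA pa; set w' := A^T *m w *m A.
have w'A : w'^T = - w'.
  by rewrite /w' !trmx_mul trmxK wA mulNmx mulmxN mulmxA.
have E : a = 2^-1 *: \sum_i \sum_j coef2 a i j *: wedge (edx R i) (edx R j).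
  rewrite -[LHS]wedge_ext1r (wedge_two_form _ pa); congr (_ *: _).
  by apply: eq_bigr => i _; apply: eq_bigr => j _; rewrite wedge_edx_ext1.
rewrite E [in RHS]bicontrZ [in RHS]epullZ [in LHS]epullZ [in LHS]bicontrZ.
congr (_ *: _).
rewrite [in RHS]bicontr_sum [in RHS]epull_sum [in LHS]epull_sum [in LHS]bicontr_sum.
apply: eq_bigr => i _.
rewrite [in RHS]bicontr_sum [in RHS]epull_sum [in LHS]epull_sum [in LHS]bicontr_sum.
apply: eq_bigr => j _.
rewrite [in RHS]bicontrZ [in RHS]epullZ [in LHS]epullZ [in LHS]bicontrZ.
congr (_ *: _).
rewrite epull_edx2 (bicontr_edx2 _ _ w'A) epullZ epull_ext1.
rewrite /pullcol wedge_suml bicontr_sum.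
under eq_bigr => k _.
  rewrite wedge_sumr bicontr_sum.
  under eq_bigr do rewrite wedgeZl wedgeZr !bicontrZ bicontr_edx2// !scalerA.
  rewrite -scaler_suml; over.
rewrite -scaler_suml; congr (_ *: _).
rewrite !mxE -sumrN exchange_big; apply: eq_bigr => l _.
rewrite !mxE mulr_suml -sumrN; apply: eq_bigr => k _.
by rewrite !mxE; ring.
Qed.

End Pullback.

Section PullbackDifferential.
Variables (R : realType) (m : nat) (O O' : set 'rV[R]_m).
Hypotheses (oO : open O) (oO' : open O').
Variable tau : 'rV[R]_m -> 'rV[R]_m.
Hypothesis tauO : forall x, O x -> O' (tau x).
Hypothesis tau_smooth : forall l, cinfty O (fun x => tau x 0 l).

Definition jac (x : 'rV[R]_m) : 'M[R]_m := \matrix_(k, l) pd k (fun y => tau y 0 l) x.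

Lemma pullcol_jac i x : pullcol (jac x) i = dfun (fun y => tau y 0 i) x.
Proof. by apply: eq_bigr => k _; rewrite mxE. Qed.

Lemma pd_comp k (f : 'rV[R]_m -> R) x : cinfty O' f -> O x ->
  pd k (f \o tau) x = \sum_l pd l f (tau x) * pd k (fun y => tau y 0 l) x.
Proof.
move=> cf Ox.
have df := cinfty_differentiable oO' (tauO Ox) cf.
have dt : derivable tau x (basisv R k).
  apply/derivable_mxP => i j; rewrite ord1.
  exact: cinfty_derivable (tau_smooth j) Ox.
have [_ E] := chain_rule df dt.
rewrite pdE E; apply: eq_bigr => l _; by rewrite !pdE.
Qed.

Lemma dfun_comp (f : 'rV[R]_m -> R) x : cinfty O' f -> O x ->
  dfun (f \o tau) x = \sum_l pd l f (tau x) *: dfun (fun y => tau y 0 l) x.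
Proof.
move=> cf Ox; rewrite /dfun; under eq_bigr do rewrite pd_comp// scaler_suml.
rewrite exchange_big; apply: eq_bigr => l _; rewrite scaler_sumr.
by apply: eq_bigr => k _; rewrite scalerA.
Qed.

(** The columns of the Jacobian matrix are exact 1-forms, so that only the
    coefficients of [eta] are differentiated, by the chain rule. *)
Lemma dE_pull (eta : 'rV[R]_m -> ext m R) x : smooth_ext O' eta ->
  (forall y, O' y -> pure 1 (eta y)) -> O x ->
  dE (fun y => epull (jac y) (eta (tau y))) x = epull (jac x) (dE eta (tau x)).
Proof.
move=> se pe Ox.
have Oy := tauO Ox.
have se' i : cinfty O' (fun y => eta y [set i]%SET) by case: se.
have ce i : cinfty O ((fun y => eta y [set i]%SET) \o tau).
  exact: (cinfty_comp oO oO' tauO tau_smooth (se' i)).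
have sd i : smooth_ext O (dfun (fun y => tau y 0 i)).
  apply: smooth_ext_sum => // k; apply: smooth_extZ => //.
    exact: cinfty_pd.
  exact: smooth_ext_cst.
rewrite (@dE_eq _ _ _ oO _ (fun y => \sum_i eta (tau y) [set i]%SET *:
    dfun (fun y => tau y 0 i) y) _ Ox); last first.
  move=> y Oy'; rewrite epull_one_form; last by apply: pe; exact: tauO.
  by apply: eq_bigr => i _; rewrite pullcol_jac.
rewrite (dE_sum oO)//; last first.
  by move=> i; apply: smooth_extZ => //; exact: (ce i).
have E : dE eta (tau x) = \sum_i \sum_l
    pd l (fun y => eta y [set i]%SET) (tau x) *: wedge (edx R l) (edx R i).
  rewrite exchange_big /dE; apply: eq_bigr => l _.
  rewrite (one_form (@pure_pdext _ _ _ oO' 1 l _ _ pe Oy)) linear_sum; apply: eq_bigr => i _.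
  by rewrite linearZ /= ffunE.
rewrite E epull_sum; apply: eq_bigr => i _.
rewrite (dEZ oO (ce i) (sd i) Ox) epull_sum.
have -> : dE (dfun (fun y => tau y 0 i)) x = 0.
  rewrite -(dE_dE oO (a := fun y => tau y 0 i *: ext1 R m) _ Ox); last first.
    by apply: smooth_extZ => //; exact: smooth_ext_cst.
  by apply: (dE_eq oO Ox) => y Oy'; rewrite (dE_ext1 oO).
rewrite scaler0 addr0 (dfun_comp (se' i) Ox) wedge_suml; apply: eq_bigr => l _.
by rewrite wedgeZl epullZ epull_edx2 !pullcol_jac.
Qed.

End PullbackDifferential.
(** * From the manifold to a chart *)

Section Manifold.
Local Open Scope classical_set_scope.
Variables (R : realType) (m : nat) (M : smoothManifold R m).
Implicit Types (c : cindex M) (U V : set M) (f g : M -> R) (p q : M).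

(** The part of [U] covered by the chart [c], seen in the chart. *)
Definition cimg c U : set 'rV[R]_m := chart c @` (U `&` cdom c).

Lemma cimgP c U x : cimg c U x ->
  [/\ U (cinv c x), cdom c (cinv c x) & chart c (cinv c x) = x].
Proof. by case=> p [Up cp] <-; rewrite chartK. Qed.

Lemma cimg_chart c U p : U p -> cdom c p -> cimg c U (chart c p).
Proof. by move=> Up cp; exists p. Qed.

Lemma cimg_open c U : open U -> open (cimg c U).
Proof.
move=> oU; rewrite openE => _ [p [Up cp] <-].
have Uc : nbhs (chart c p) (cinv c @^-1` U).
  apply: (cinv_continuous cp); rewrite chartK//; exact: open_nbhs_nbhs.
have Cc : nbhs (chart c p) (chart c @` cdom c).
  by apply: open_nbhs_nbhs; split; [exact: chart_open|exists p].
apply: filterS (filterI Uc Cc) => y [Uy [q cq Ey]].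
by exists q => //; split=> //; rewrite -(chartK cq) Ey.
Qed.

Lemma cimg_sub c U V : U `<=` V -> cimg c U `<=` cimg c V.
Proof. by move=> UV _ [p [/UV Vp cp] <-]; exists p. Qed.

Lemma smooth_on_cimg c U f : smooth_on U f -> cinfty (cimg c U) (f \o cinv c).
Proof. by move/(_ c). Qed.

Lemma transition_cimg c c' U l :
  cinfty (cimg c (U `&` cdom c')) (fun x => chart c' (cinv c x) 0 l).
Proof.
apply: (cinfty_sub _ (@transition_smooth _ _ M c c' l)) => _ [p [[_ c'p] cp] <-].
by exists p.
Qed.

(** In any other chart [f] is the composite with a transition map. *)
Lemma smooth_on_chart c U f : open U -> U `<=` cdom c ->
  cinfty (cimg c U) (f \o cinv c) -> smooth_on U f.
Proof.
move=> oU Uc cf c'.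
have oU' := cimg_open (c := c') oU.
have T x : cimg c' U x -> cimg c U (chart c (cinv c' x)).
  by move=> /cimgP[Ux c'x _]; apply: cimg_chart => //; exact: Uc.
apply: (cinfty_eq oU' _ (cinfty_comp oU' (cimg_open oU) T _ cf)).
  by move=> x /cimgP[Ux _ _] /=; rewrite chartK//; exact: Uc.
move=> l; apply: (cinfty_sub _ (@transition_smooth _ _ M c' c l)) => _ [p [Up cp] <-].
by exists p; split => //; exact: Uc.
Qed.

Lemma smooth_on_sub U V f : V `<=` U -> smooth_on U f -> smooth_on V f.
Proof. by move=> VU sf c; apply: cinfty_sub (sf c); exact: cimg_sub. Qed.

Lemma smooth_on_eq U f g : open U -> (forall p, U p -> f p = g p) ->
  smooth_on U f -> smooth_on U g.
Proof.
move=> oU fg sf c; apply: (cinfty_eq (cimg_open (c := c) oU) _ (sf c)).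
by move=> x /cimgP[Ux _ _] /=; exact: fg.
Qed.

Lemma smooth_onM U f g : open U -> smooth_on U f -> smooth_on U g ->
  smooth_on U (fun p => f p * g p).
Proof. by move=> oU sf sg c; apply: (cinftyM (cimg_open oU) (sf c) (sg c)). Qed.

Lemma smooth_onD U f g : open U -> smooth_on U f -> smooth_on U g ->
  smooth_on U (fun p => f p + g p).
Proof. by move=> oU sf sg c; apply: (cinftyD (cimg_open oU) (sf c) (sg c)). Qed.

Lemma smooth_on_cst U (k : R) : open U -> smooth_on U (fun=> k).
Proof. by move=> oU c; apply: (cinfty_cst k (cimg_open oU)). Qed.

Lemma cpartialE c k f p : cpartial c k f p = pd k (f \o cinv c) (chart c p).
Proof. by rewrite pdE. Qed.

Lemma ext_dE c (a : M -> ext m R) p :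
  ext_d c a p = dE (a \o cinv c) (chart c p).
Proof.
apply: eq_bigr => k _; congr wedge; apply/ffunP => K; rewrite !ffunE.
by rewrite cpartialE.
Qed.

Lemma jacobianE c c' p :
  Defs.jacobian c c' p = jac (fun x => chart c' (cinv c x)) (chart c p).
Proof. by apply/matrixP => k l; rewrite !mxE cpartialE. Qed.

Lemma fun_dE c U f p : open U -> smooth_on U f -> U p -> cdom c p ->
  fun_d c f p = dfun (f \o cinv c) (chart c p).
Proof.
move=> oU sf Up cp; rewrite /fun_d ext_dE.
exact: (dE_ext1 (cimg_open oU) (smooth_on_cimg sf) (cimg_chart Up cp)).
Qed.

Lemma pd_proj i k (x : 'rV[R]_m) : pd k (fun y : 'rV[R]_m => y 0 i) x = (i == k)%:R.
Proof.
have E : (fun y : 'rV[R]_m => y 0 i) = dual_form (fun j => (j == i)%:R).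
  apply/funext => y; rewrite /dual_form (bigD1 i)//= eqxx mulr1 big1 ?addr0//.
  by move=> j /negbTE ->; rewrite mulr0.
have cf := @dual_form_continuous R m (fun j => (j == i)%:R).
rewrite pdE E deriveE; last exact: linear_differentiable.
by rewrite diff_lin//; have /= <- := congr1 (fun F : 'rV[R]_m -> R => F (basisv R k)) E; rewrite mxE eqxx.
Qed.

Section Poisson.
Variable w : poissonStructure M.

Definition wloc c (x : 'rV[R]_m) : 'M[R]_m := w c (cinv c x).

Lemma wloc_chart c p : cdom c p -> wloc c (chart c p) = w c p.
Proof. by move=> cp; rewrite /wloc chartK. Qed.

Lemma wloc_smooth c U i j : cinfty (cimg c U) (fun x => wloc c x i j).
Proof.
apply: (cinfty_sub _ (@bivec_smooth _ _ _ w c i j c)) => _ [p [_ cp] <-].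
by exists p.
Qed.

Lemma wloc_anti c U x : cimg c U x -> (wloc c x)^T = - wloc c x.
Proof. by move=> /cimgP[_ cx _]; exact: bivec_antisym. Qed.

Lemma coord_smooth c i : smooth_on (cdom c) (fun p => chart c p 0 i).
Proof.
move=> c'; apply: (cinfty_sub _ (@transition_smooth _ _ M c' c i)) => _ [p [cp c'p] <-].
by exists p.
Qed.

Lemma pd_coord c i k p : cdom c p ->
  cpartial c k (fun q => chart c q 0 i) p = (i == k)%:R.
Proof.
move=> cp; rewrite cpartialE.
have oO := cimg_open (c := c) (cdom_open c).
rewrite (@pd_eq _ _ _ oO k _ (fun x => x 0 i)); [|exact: cimg_chart|]; last first.
  by move=> x /cimgP[_ _ E] /=; rewrite E.
exact: pd_proj.
Qed.

Lemma pbracket_coord c i j p : cdom c p ->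
  pbracket c (w c) (fun q => chart c q 0 i) (fun q => chart c q 0 j) p = w c p i j.
Proof.
move=> cp; rewrite /pbracket (bigD1 i)//= [X in _ + X]big1 ?addr0; last first.
  move=> k /negbTE ki; apply: big1 => l _.
  by rewrite (pd_coord i k cp) eq_sym ki mulr0 mul0r.
rewrite (bigD1 j)//= big1 ?addr0; last first.
  by move=> l /negbTE lj; rewrite (pd_coord j l cp) eq_sym lj mulr0.
by rewrite !(pd_coord _ _ cp) !eqxx !mulr1.
Qed.

Lemma pbracket_coord_l c i f p : cdom c p ->
  pbracket c (w c) (fun q => chart c q 0 i) f p = \sum_k w c p i k * cpartial c k f p.
Proof.
move=> cp; rewrite /pbracket (bigD1 i)//= [X in _ + X]big1 ?addr0; last first.
  move=> k /negbTE ki; apply: big1 => l _.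
  by rewrite (pd_coord i k cp) eq_sym ki mulr0 mul0r.
by apply: eq_bigr => k _; rewrite (pd_coord i i cp) eqxx mulr1.
Qed.

(** This is the Jacobi identity of the bracket for three coordinate functions of [c]. *)
Lemma wloc_jacobi c U x : cimg c U x -> forall i j l,
  \sum_k (wloc c x i k * pd k (fun y => wloc c y j l) x
    + wloc c x j k * pd k (fun y => wloc c y l i) x
    + wloc c x l k * pd k (fun y => wloc c y i j) x) = 0.
Proof.
move=> /cimgP[_ cx Ex] i j l.
have J := @bivec_jacobi _ _ _ w c (cdom c) _ _ _ (cdom_open c) (@subset_refl _ _)
  (@coord_smooth c i) (@coord_smooth c j) (@coord_smooth c l) _ cx.
have B a b e : pbracket c (w c) (fun q => chart c q 0 a)
    (pbracket c (w c) (fun q => chart c q 0 b) (fun q => chart c q 0 e)) (cinv c x) =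
    \sum_k wloc c x a k * pd k (fun y => wloc c y b e) x.
  rewrite pbracket_coord_l//; apply: eq_bigr => k _; congr (_ * _).
  rewrite cpartialE Ex; apply: (pd_eq (cimg_open (cdom_open c))).
    by rewrite -Ex; exact: cimg_chart.
  by move=> y /cimgP[_ cy _]; exact: pbracket_coord.
by rewrite !big_split /= -!B.
Qed.

End Poisson.
End Manifold.

(** ** Frames of a fibre *)

Section Fibre.
Variables (R : realType) (m r : nat) (V : vectType R) (X : r.-tuple V).
Hypothesis bX : basis_of fullv X.

Lemma coord_frame j k : coord X k (tnth X j) = (j == k)%:R.
Proof. by rewrite (tnth_nth 0) coord_free// (basis_free bX). Qed.

Lemma frame_expand (v : V) : v = \sum_k coord X k v *: tnth X k.
Proof.
rewrite {1}(coord_basis bX (memvf v)); apply: eq_bigr => k _.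
by rewrite (tnth_nth 0).
Qed.

Lemma ecomp_sum (a : 'I_r -> ext m R) k :
  ecomp X k (\sum_j etens (a j) (tnth X j)) = a k.
Proof.
apply/ffunP => K; rewrite ffunE sum_ffunE linear_sum (bigD1 k)//= big1 ?addr0.
  by rewrite ffunE linearZ /= coord_frame eqxx mulr1.
by move=> j /negbTE jk; rewrite ffunE linearZ /= coord_frame jk mulr0.
Qed.

Lemma ecomp_expand (a : ext m V) : a = \sum_k etens (ecomp X k a) (tnth X k).
Proof.
apply/ffunP => K; rewrite sum_ffunE {1}(frame_expand (a K)).
by apply: eq_bigr => k _; rewrite !ffunE.
Qed.

Lemma ecompD k (a b : ext m V) : ecomp X k (a + b) = ecomp X k a + ecomp X k b.
Proof. by apply/ffunP => K; rewrite !ffunE linearD. Qed.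

Lemma ecompZ k (f : R) (a : ext m V) : ecomp X k (f *: a) = f *: ecomp X k a.
Proof. by apply/ffunP => K; rewrite !ffunE linearZ. Qed.

Lemma ecomp_sumr k (T : finType) (F : T -> ext m V) :
  ecomp X k (\sum_x F x) = \sum_x ecomp X k (F x).
Proof.
apply/ffunP => K; rewrite ffunE !sum_ffunE linear_sum.
by apply: eq_bigr => x _; rewrite ffunE.
Qed.

Lemma ecomp_etens k (a : ext m R) (v : V) : ecomp X k (etens a v) = coord X k v *: a.
Proof. by apply/ffunP => K; rewrite !ffunE linearZ /= mulrC. Qed.

Lemma ecomp_change (Y : r.-tuple V) k (a : ext m V) :
  ecomp Y k a = \sum_j coord Y k (tnth X j) *: ecomp X j a.
Proof.
rewrite {1}(ecomp_expand a); apply/ffunP => K.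
rewrite ffunE !sum_ffunE linear_sum; apply: eq_bigr => j _.
by rewrite !ffunE linearZ /= mulrC.
Qed.

Lemma ecomp_inj (a b : ext m V) : (forall k, ecomp X k a = ecomp X k b) -> a = b.
Proof.
move=> ab; rewrite (ecomp_expand a) (ecomp_expand b).
by apply: eq_bigr => k _; rewrite ab.
Qed.

Definition frame_end (A : 'I_r -> 'I_r -> R) : 'End(V) :=
  linfun (fun v => \sum_j \sum_k (coord X j v * A j k) *: tnth X k).

Lemma frame_end_is_linear (A : 'I_r -> 'I_r -> R) :
  linear (fun v => \sum_j \sum_k (coord X j v * A j k) *: tnth X k).
Proof.
move=> f u v; rewrite scaler_sumr -big_split; apply: eq_bigr => j _.
rewrite scaler_sumr -big_split; apply: eq_bigr => k _.
by rewrite linearP mulrDl scalerDl scalerA mulrA.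
Qed.

Lemma frame_endE A v : frame_end A v = \sum_j \sum_k (coord X j v * A j k) *: tnth X k.
Proof.
pose L := GRing.isLinear.Build R V V _ _ (frame_end_is_linear A).
pose F : {linear V -> V} := HB.pack (fun v => \sum_j \sum_k (coord X j v * A j k) *: tnth X k) L.
by rewrite /frame_end -[LHS]/(linfun F v) lfunE.
Qed.

(** Two matrices related by a change of frame represent one endomorphism. *)
Lemma frame_end_change (Y : r.-tuple V) (A B : 'I_r -> 'I_r -> R) j k :
  basis_of fullv Y ->
  (forall b, \sum_a coord X a (tnth Y j) * A a b = \sum_a coord X b (tnth Y a) * B j a) ->
  coord Y k (frame_end A (tnth Y j)) = B j k.
Proof.
move=> bY AB.
have Z a : \sum_b coord X b (tnth Y a) * coord Y k (tnth X b) = (a == k)%:R.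
  have free : coord Y k (tnth Y a) = (a == k)%:R.
    by rewrite (tnth_nth 0) coord_free// (basis_free bY).
  rewrite -free [in RHS](frame_expand (tnth Y a)) linear_sum.
  by apply: eq_bigr => b _; rewrite linearZ.
rewrite frame_endE linear_sum; under eq_bigr do rewrite linear_sum.
rewrite exchange_big /=.
transitivity (\sum_b \sum_a coord X b (tnth Y a) * B j a * coord Y k (tnth X b)).
  apply: eq_bigr => b _; rewrite -mulr_suml -AB mulr_suml.
  by apply: eq_bigr => a _; rewrite linearZ.
rewrite exchange_big (bigD1 k)//= [X in _ + X]big1 ?addr0.
  under eq_bigr do rewrite mulrAC.
  by rewrite -mulr_suml Z eqxx mul1r.
move=> a /negbTE ak; under eq_bigr do rewrite mulrAC.
by rewrite -mulr_suml Z ak mul0r.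
Qed.

Lemma frame_end0 A : (forall j k, A j k = 0) -> frame_end A = 0.
Proof.
move=> A0; apply/lfunP => v; rewrite frame_endE zero_lfunE.
by apply: big1 => j _; apply: big1 => k _; rewrite A0 mulr0 scale0r.
Qed.

End Fibre.

(** ** Connections in a chart and a frame *)

Section Bundle.
Local Open Scope classical_set_scope.
Variables (R : realType) (m r : nat) (M : smoothManifold R m).
Variables (w : poissonStructure M) (E : vectorBundle M r) (D : connection E).
Implicit Types (c : cindex M) (t : tindex E) (U : set M) (p q : M).
Implicit Types (Phi : hform (fun p => E p)).

Definition local_conn c t j k (x : 'rV[R]_m) : ext m R := conn_form D t j k c (cinv c x).

Definition frame_comp c t Phi n k q : ext m R := ecomp (frame t q) k (Phi n c q).

Definition local_comp c t Phi n k (x : 'rV[R]_m) : ext m R := frame_comp c t Phi n k (cinv c x).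

Lemma frame_section t j : smooth_section_on (tdom t) (fun q => tnth (frame t q) j).
Proof. by move=> t' k; exact: frame_smooth. Qed.

Lemma smooth_on_ext c U (a : M -> ext m R) :
  (forall K, smooth_on (U `&` cdom c) (fun p => a p K)) ->
  smooth_ext (cimg c U) (fun x => a (cinv c x)).
Proof.
move=> sa; split=> K; apply: (cinfty_sub _ (smooth_on_cimg (c := c) (sa K))).
by move=> _ [p [Up cp] <-]; exists p.
Qed.

Lemma local_conn_connection c t : connection_on (cimg c (tdom t)) (local_conn c t).
Proof.
split=> j k.
  have [F _] := nabla_form D (tdom_open t) (@frame_section t j).
  have [sF _] := F t k; rewrite setIid in sF.
  exact: (@smooth_on_ext c (tdom t) (conn_form D t j k c)).
move=> x /cimgP[tx cx _]; apply: pureP => K K1; rewrite ffunE.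
have [_ N] := nabla_form D (tdom_open t) (@frame_section t j).
have [->|/(N _ _ _ tx cx) E1] := eqVneq (D (fun q => tnth (frame t q) j) c (cinv c x) K) 0.
  by rewrite linear0.
by rewrite E1 in K1.
Qed.

Lemma local_conn_sub c t U : U `<=` tdom t -> connection_on (cimg c U) (local_conn c t).
Proof.
move=> Ut; have [s p1] := local_conn_connection c t; split=> j k.
  by split=> K; apply: cinfty_sub (smooth_extE (s j k) K); exact: cimg_sub.
by move=> x /(cimg_sub Ut); exact: p1.
Qed.

Lemma local_comp_smooth c t Phi n : is_hEform Phi ->
  smooth_vec (cimg c (tdom t)) (local_comp c t Phi n).
Proof.
move=> [/(_ n) F _] k; have [sF _] := F t k; rewrite setTI in sF.
exact: (@smooth_on_ext c (tdom t) (frame_comp c t Phi n k)).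
Qed.

Lemma local_comp_smooth_sub c t U Phi n : U `<=` tdom t -> is_hEform Phi ->
  smooth_vec (cimg c U) (local_comp c t Phi n).
Proof.
move=> Ut /(local_comp_smooth c t n) s k; split=> K.
by apply: cinfty_sub (smooth_extE (s k) K); exact: cimg_sub.
Qed.

Definition qDcov c t (u : nat -> 'I_r -> 'rV[R]_m -> ext m R) (n : nat) k x : ext m R :=
  Dcov (local_conn c t) (u n) k x -
  (if n is n'.+1 then vcom (wloc w c) (Dcov (local_conn c t)) (u n') k x else 0).

Lemma qDcov_eq c t (u v : nat -> 'I_r -> 'rV[R]_m -> ext m R) n k x :
  cimg c (tdom t) x ->
  (forall i l y, cimg c (tdom t) y -> u i l y = v i l y) ->
  qDcov c t u n k x = qDcov c t v n k x.
Proof.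
move=> Ox uv; have oO := cimg_open (c := c) (tdom_open t).
rewrite /qDcov (Dcov_eq oO _ _ Ox (uv n)); case: n => [|n]; first by [].
by rewrite (vcom_eq oO _ _ _ Ox (uv n)).
Qed.

Lemma qcovd_in_comp c t Phi n k p : tdom t p -> cdom c p ->
  ecomp (frame t p) k (qcovd_in w D t Phi n c p) = qDcov c t (local_comp c t Phi) n k (chart c p).
Proof.
move=> tp cp; rewrite /qcovd_in ecomp_sum; last exact: frame_basis.
have xO := cimg_chart tp cp.
have wA : (w c p)^T = - w c p := bivec_antisym w cp.
have E1 j : local_conn c t j k (chart c p) = conn_form D t j k c p by rewrite /local_conn chartK.
have E2 n' j : local_comp c t Phi n' j (chart c p) = frame_comp c t Phi n' j p by rewrite /local_comp chartK.
have p1 j : pure 1 (conn_form D t j k c p).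
  by rewrite -E1; exact: (local_conn_connection c t).2.
rewrite (eq_bigr (fun j => wedge (conn_form D t j k c p) (frame_comp c t Phi n j p) -
    com (w c p) (wedge (conn_form D t j k c p))
      (hshift 1 (fun i => frame_comp c t Phi i j p) n))); last first.
  by move=> j _; rewrite qwedge_one_form.
rewrite sumrB /qd /qDcov ext_dE addrACA -opprD; congr (_ - _).
  by rewrite /Dcov; congr (_ + _); apply: eq_bigr => j _; rewrite E1 E2.
case: n => [|n].
  rewrite addr0; apply: big1 => j _; rewrite /hshift /com /= [wedge _ 0]linear0.
  by rewrite [bicontr _ 0]linear0 [wedge _ 0]linear0 subr0.
have A : koszul w c (fun q => ecomp (frame t q) k (Phi n c q)) p =
    koszulE (wloc w c) (local_comp c t Phi n k) (chart c p).
  by rewrite /koszul !ext_dE /koszulE /iota (wloc_chart w cp).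
have B j : com (w c p) (wedge (conn_form D t j k c p))
      (hshift 1 (fun i => frame_comp c t Phi i j p) n.+1) =
    com (wloc w c (chart c p)) (wedge (local_conn c t j k (chart c p)))
      (local_comp c t Phi n j (chart c p)).
  by rewrite E1 E2 (wloc_chart w cp) /hshift /= subn1.
rewrite A (eq_bigr _ (fun j _ => B j)); exact/esym/vcom_formula.
Qed.

(** ** Change of frame *)

Lemma smooth_section_eq U (s s' : forall p, E p) : open U ->
  (forall p, U p -> s p = s' p) -> smooth_section_on U s -> smooth_section_on U s'.
Proof.
move=> oU ss' H t k.
apply: (smooth_on_eq _ _ (H t k)); first exact: openI (tdom_open t).
by move=> p [Up _]; rewrite ss'.
Qed.

Lemma smooth_section0 U : open U -> smooth_section_on U (fun p => 0 : E p).
Proof.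
move=> oU t k.
have oUt : open (U `&` tdom t) by exact: openI (tdom_open t).
by apply: (smooth_on_eq oUt _ (smooth_on_cst 0 oUt)) => p _; rewrite linear0.
Qed.

Lemma smooth_sectionZ U (f : M -> R) (s : forall p, E p) : open U ->
  smooth_on U f -> smooth_section_on U s -> smooth_section_on U (fun p => f p *: s p).
Proof.
move=> oU sf ss t k.
have oUt : open (U `&` tdom t) by exact: openI (tdom_open t).
have sf' : smooth_on (U `&` tdom t) f by apply: smooth_on_sub sf => p [].
apply: (smooth_on_eq oUt _ (smooth_onM oUt sf' (ss t k))) => p _.
by rewrite linearZ.
Qed.

Lemma smooth_sectionD U (s s' : forall p, E p) : open U ->
  smooth_section_on U s -> smooth_section_on U s' ->
  smooth_section_on U (fun p => s p + s' p).
Proof.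
move=> oU ss ss' t k.
have oUt : open (U `&` tdom t) by exact: openI (tdom_open t).
apply: (smooth_on_eq oUt _ (smooth_onD oUt (ss t k) (ss' t k))) => p _.
by rewrite linearD.
Qed.

Lemma etens_0r (V : lmodType R) (a : ext m R) : etens a (0 : V) = 0.
Proof. by apply/ffunP => K; rewrite !ffunE scaler0. Qed.

(** The axioms speak of sums of two sections; the empty sum is the section
    [0 *: 0], to which the Leibniz rule applies. *)
Lemma nabla_sum U (I : Type) (l : seq I) (f : I -> M -> R)
    (s : I -> forall p, E p) : open U ->
  (forall i, smooth_on U (f i)) -> (forall i, smooth_section_on U (s i)) ->
  smooth_section_on U (fun q => \sum_(i <- l) f i q *: s i q) /\
  forall c p, U p -> cdom c p ->
  D (fun q => \sum_(i <- l) f i q *: s i q) c p =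
  \sum_(i <- l) (f i p *: D (s i) c p + etens (fun_d c (f i) p) (s i p)).
Proof.
move=> oU sf ss; elim: l => [|i l [IHs IH]].
  have s0 := smooth_section0 oU.
  have z0 : smooth_section_on U (fun q => \sum_(i <- [::]) f i q *: s i q).
    by apply: smooth_section_eq s0 => // q _; rewrite big_nil.
  split=> // c p Up cp; rewrite big_nil.
  have c0 := smooth_on_cst 0 oU.
  have zz := smooth_sectionZ oU c0 s0.
  rewrite (nabla_local D oU z0 zz) //; last by move=> q _; rewrite big_nil scale0r.
  by rewrite (nabla_leibniz D oU c0 s0)// scale0r etens_0r addr0.
have si := smooth_sectionZ oU (sf i) (ss i).
have sil := smooth_sectionD oU si IHs.
have sc : smooth_section_on U (fun q => \sum_(j <- i :: l) f j q *: s j q).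
  by apply: smooth_section_eq sil => // q _; rewrite big_cons.
split=> // c p Up cp; rewrite big_cons -IH//.
rewrite (nabla_local D oU sc sil)//; last by move=> q _; rewrite big_cons.
by rewrite (nabla_add D oU si IHs)// (nabla_leibniz D oU (sf i) (ss i)).
Qed.

(** The matrix of the frame [t] in the frame [t']. *)
Definition frame_trans t t' j k q : R := coord (frame t' q) k (tnth (frame t q) j).

Definition local_trans c t t' j k (x : 'rV[R]_m) : R := frame_trans t t' j k (cinv c x).

Lemma local_trans_smooth c t t' j k : cinfty (cimg c (tdom t `&` tdom t')) (local_trans c t t' j k).
Proof. exact: (@frame_smooth _ _ _ _ E t t' j k c). Qed.

(** Apply the connection to the expansion of the frame [t] in the frame [t']. *)
Lemma local_conn_gauge c t t' :
  gauge_related (cimg c (tdom t `&` tdom t')) (local_trans c t t') (local_conn c t) (local_conn c t').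
Proof.
move=> j k x Ox; have [[tp t'p] cp Ex] := cimgP Ox; set p := cinv c x in tp t'p cp Ex.
have oU : open (tdom t `&` tdom t') by apply: openI; exact: tdom_open.
have bt := frame_basis tp; have bt' := frame_basis t'p.
have sg l : smooth_on (tdom t `&` tdom t') (frame_trans t t' j l) by exact: frame_smooth.
have ss l : smooth_section_on (tdom t `&` tdom t') (fun q => tnth (frame t' q) l).
  by move=> t1 k1; apply: (smooth_on_sub _ (@frame_smooth _ _ _ _ E t' t1 l k1)) => q [[]].
have sj : smooth_section_on (tdom t `&` tdom t') (fun q => tnth (frame t q) j).
  by move=> t1 k1; apply: (smooth_on_sub _ (@frame_smooth _ _ _ _ E t t1 j k1)) => q [[]].
have [sS nS] := nabla_sum (index_enum 'I_r) oU sg ss.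
have N : D (fun q => tnth (frame t q) j) c p = \sum_l
    (frame_trans t t' j l p *: D (fun q => tnth (frame t' q) l) c p +
     etens (fun_d c (frame_trans t t' j l) p) (tnth (frame t' p) l)).
  rewrite -nS//; apply: (nabla_local D oU sj sS) => // q [_ t'q].
  exact: (frame_expand (frame_basis t'q)).
have := congr1 (ecomp (frame t' p) k) N.
rewrite (ecomp_change bt) ecomp_sumr => ->.
rewrite (eq_bigr _ (fun l _ => ecompD _ _ _ _)) big_split /= addrC; congr (_ + _).
  rewrite (bigD1 k)//= ecomp_etens coord_frame// eqxx scale1r big1 ?addr0; last first.
    by move=> l /negbTE lk; rewrite ecomp_etens coord_frame// lk scale0r.
  by rewrite (fun_dE oU (sg k))// Ex.
by apply: eq_bigr => l _; rewrite ecompZ.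
Qed.

Lemma local_comp_gauge c t t' Phi n k x : cimg c (tdom t `&` tdom t') x ->
  local_comp c t' Phi n k x = gauge (local_trans c t t') (local_comp c t Phi n) k x.
Proof.
by move=> /cimgP[[tp t'p] cp _]; exact: (ecomp_change (frame_basis tp)).
Qed.

(** Since [qcovd] chooses a frame at each point, this is what allows it to be
    iterated: near a point all the choices may be replaced by one frame. *)
Lemma qcovd_in_frame t t' Phi n c p : is_hEform Phi ->
  tdom t p -> tdom t' p -> cdom c p ->
  qcovd_in w D t Phi n c p = qcovd_in w D t' Phi n c p.
Proof.
move=> hPhi tp t'p cp; apply: (ecomp_inj (frame_basis t'p)) => k.
rewrite (ecomp_change (frame_basis tp)) (qcovd_in_comp _ _ _ t'p cp).
under eq_bigr do rewrite (qcovd_in_comp _ _ _ tp cp).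
have Ox : cimg c (tdom t `&` tdom t') (chart c p) by exact: cimg_chart.
have oU : open (tdom t `&` tdom t') by apply: openI; exact: tdom_open.
have oO := cimg_open (c := c) oU.
have cg j l := @local_trans_smooth c t t' j l.
have rel := @local_conn_gauge c t t'.
have su i : smooth_vec (cimg c (tdom t `&` tdom t')) (local_comp c t Phi i).
  by apply: local_comp_smooth_sub => // q [].
have gE i l y := @local_comp_gauge c t t' Phi i l y.
have tE j : coord (frame t' p) k (tnth (frame t p) j) = local_trans c t t' j k (chart c p).
  by rewrite /local_trans chartK.
under eq_bigr do rewrite tE.
rewrite /qDcov; rewrite (Dcov_eq oO _ _ Ox (gE n)) (Dcov_gauge oO k cg rel (su n) Ox).
case: n => [|n]; first by rewrite subr0; apply: eq_bigr => j _; rewrite subr0.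
rewrite (vcom_eq oO _ _ _ Ox (gE n)).
rewrite (vcom_gauge oO (@wloc_smooth _ _ _ w c _) k cg rel (su n) Ox).
by rewrite /gauge -sumrB; apply: eq_bigr => j _; rewrite scalerBr.
Qed.

Lemma qcovd_comp t Phi n c k p : is_hEform Phi -> tdom t p -> cdom c p ->
  ecomp (frame t p) k (qcovd w D Phi n c p) = qDcov c t (local_comp c t Phi) n k (chart c p).
Proof.
move=> hPhi tp cp; rewrite /qcovd (qcovd_in_frame _ hPhi (triv_atP E p) tp cp).
exact: qcovd_in_comp.
Qed.

(** Multiplication by h on sequences of coefficients. *)
Definition hmul (u : nat -> 'I_r -> 'rV[R]_m -> ext m R) (n : nat) :=
  if n is n'.+1 then u n' else fun _ _ => 0.

Lemma qDcovE c t u n k x : cimg c (tdom t) x ->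
  qDcov c t u n k x = Dcov (local_conn c t) (u n) k x -
    vcom (wloc w c) (Dcov (local_conn c t)) (hmul u n) k x.
Proof.
move=> Ox; case: n => [|n]//; rewrite /qDcov /hmul.
by rewrite (vcom0 (cimg_open (tdom_open t)) _ _ _ Ox).
Qed.

(** With [h] written as a shift of the coefficients, [quantum_square] gives the left
    side and [qwedge_qcurv] the right one. *)
Lemma qDcov_qDcov c t (u : nat -> 'I_r -> 'rV[R]_m -> ext m R) n k x :
  (forall i, smooth_vec (cimg c (tdom t)) (u i)) -> cimg c (tdom t) x ->
  qDcov c t (qDcov c t u) n k x =
  \sum_i qwedge (wloc w c x) (qcurv (wloc w c x) (curv (local_conn c t) i k x))
    (fun a => u a i x) n.
Proof.
move=> su Ox; have oO := cimg_open (c := c) (tdom_open t).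
have ct := local_conn_connection c t.
have sh v : (forall i, smooth_vec (cimg c (tdom t)) (v i)) ->
    forall i, smooth_vec (cimg c (tdom t)) (hmul v i).
  by move=> sv [|i] //= l; exact: smooth_ext0.
rewrite qDcovE//.
rewrite (@Dcov_eq _ _ _ oO _ _ _ (fun k y => Dcov (local_conn c t) (u n) k y -
    vcom (wloc w c) (Dcov (local_conn c t)) (hmul u n) k y) k x Ox); last first.
  by move=> l y Oy; exact: qDcovE.
rewrite (@vcom_eq _ _ _ oO _ _ _ _ (fun k y => Dcov (local_conn c t) (hmul u n) k y -
    vcom (wloc w c) (Dcov (local_conn c t)) (hmul (hmul u) n) k y) k x Ox); last first.
  move=> l y Oy; case: n => [|n] /=; last exact: qDcovE.
  by rewrite Dcov0 (vcom0 oO)// subr0.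
rewrite (quantum_square oO (@wloc_smooth _ _ _ w c _) (@wloc_anti _ _ _ w c _)
  (@wloc_jacobi _ _ _ w c _) k ct (su n) (sh _ su n) (sh _ (sh _ su) n) Ox).
apply: eq_bigr => i _.
rewrite qwedge_qcurv; [|exact: wloc_anti Ox|exact: pure_curv ct Ox].
have H1 : hshift 1 (fun a => u a i x) n = hmul u n i x.
  by case: n {sh} => [|n]; rewrite /hshift /= ?subn1.
have H2 : hshift 2 (fun a => u a i x) n = hmul (hmul u) n i x.
  by case: n {sh H1} => [|[|n]]; rewrite /hshift /= ?subn2.
by rewrite H1 H2.
Qed.

(** ** The quantum curvature *)

Lemma sum_extZE (T : finType) (a : T -> R) (F : T -> ext m R) K :
  (\sum_x a x *: F x) K = \sum_x a x * F x K.
Proof. by rewrite sum_ffunE; apply: eq_bigr => x _; rewrite ffunE. Qed.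

Lemma sum_extZ_eq (T : finType) (a b : T -> R) (F G : T -> ext m R) :
  \sum_x a x *: F x = \sum_x b x *: G x ->
  forall K, \sum_x a x * F x K = \sum_x b x * G x K.
Proof. by move=> H K; rewrite -!sum_extZE H. Qed.

Lemma qcurv_sum (v : 'M[R]_m) (T : finType) (a : T -> R) (F : T -> ext m R) n :
  qcurv v (\sum_x a x *: F x) n = \sum_x a x *: qcurv v (F x) n.
Proof.
case: n => [|[|n]] //=; last by rewrite big1 // => x _; rewrite scaler0.
rewrite bicontr_sum -sumrN; apply: eq_bigr => x _.
by rewrite bicontrZ scalerN.
Qed.

Lemma qcurv_degree (v : 'M[R]_m) (F : ext m R) n K : pure 2 F ->
  qcurv v F n K != 0 -> (#|K| + n.*2)%N = 2.
Proof.
case: n => [|[|n]] pF; [by move=> /pF ->| |by rewrite ffunE eqxx].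
by move=> /(pureN (pure_bicontr (w:=v) pF)) ->.
Qed.

Definition curvature_form c t j k p : ext m R := curv (local_conn c t) j k (chart c p).

(** The matrix entries are [F - h (w |- F)] for the entries [F] of the curvature
    2-form, in the frame chosen at [p]. *)
Definition quantum_curvature : hform (fun p : M => 'End(E p)%type) := fun n c p =>
  [ffun K => frame_end (frame (triv_at E p) p)
     (fun j k => qcurv (w c p) (curvature_form c (triv_at E p) j k p) n K)].

(** The curvature matrices in two frames are conjugate, so the endomorphism does not
    depend on the frame chosen at [p]. *)
Lemma endcomp_quantum_curvature c t n j k p : tdom t p -> cdom c p ->
  endcomp (frame t p) j k (quantum_curvature n c p) = qcurv (w c p) (curvature_form c t j k p) n.
Proof.
move=> tp cp; set t0 := triv_at E p; have t0p : tdom t0 p := triv_atP E p.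
have bt := frame_basis tp; have bt0 := frame_basis t0p.
have Ox : cimg c (tdom t `&` tdom t0) (chart c p) by exact: cimg_chart.
have oU : open (tdom t `&` tdom t0) by apply: openI; exact: tdom_open.
have cU : connection_on (cimg c (tdom t `&` tdom t0)) (local_conn c t).
  by apply: local_conn_sub => q [].
have cU0 : connection_on (cimg c (tdom t `&` tdom t0)) (local_conn c t0).
  by apply: local_conn_sub => q [].
have G b : \sum_a frame_trans t t0 j a p *: qcurv (w c p) (curvature_form c t0 a b p) n =
    \sum_a frame_trans t t0 a b p *: qcurv (w c p) (curvature_form c t j a p) n.
  have tE a d : frame_trans t t0 a d p = local_trans c t t0 a d (chart c p).
    by rewrite /local_trans (chartK cp).
  have H := curv_gauge (cimg_open oU) j b (@local_trans_smooth c t t0) cU cU0 (@local_conn_gauge c t t0) Ox.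
  have H' : \sum_a frame_trans t t0 j a p *: curvature_form c t0 a b p =
      \sum_a frame_trans t t0 a b p *: curvature_form c t j a p.
    transitivity (\sum_a local_trans c t t0 j a (chart c p) *: curv (local_conn c t0) a b (chart c p)).
      by apply: eq_bigr => a _; rewrite tE.
    by rewrite H; apply: eq_bigr => a _; rewrite tE.
  have S1 := qcurv_sum (w c p) (fun a => frame_trans t t0 j a p) (fun a => curvature_form c t0 a b p) n.
  have S2 := qcurv_sum (w c p) (fun a => frame_trans t t0 a b p) (fun a => curvature_form c t j a p) n.
  exact: (etrans (esym S1) (etrans (congr1 (fun F => qcurv (w c p) F n) H') S2)).
apply/ffunP => K; rewrite [LHS]ffunE [quantum_curvature _ _ _ _]ffunE.
apply: (frame_end_change (B := fun j k => qcurv (w c p) (curvature_form c t j k p) n K) bt0 k bt) => b.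
exact: (sum_extZ_eq (G b) K).
Qed.

Lemma curvature_form_pure c t j k p : tdom t p -> cdom c p -> pure 2 (curvature_form c t j k p).
Proof.
move=> tp cp; have ct := local_conn_connection c t.
exact: (pure_curv (cimg_open (tdom_open t)) ct (cimg_chart tp cp)).
Qed.

(** Only the naturality of the exterior derivative on 1-forms and of their products
    is involved. *)
Lemma curvature_form_pull c c' t j k p : tdom t p -> cdom c p -> cdom c' p ->
  curvature_form c t j k p = epull (Defs.jacobian c c' p) (curvature_form c' t j k p).
Proof.
move=> tp cp c'p; rewrite /curvature_form jacobianE.
pose U := tdom t `&` cdom c'; pose U' := tdom t `&` cdom c.
have oU : open (cimg c U).
  by apply: cimg_open; apply: openI; [exact: tdom_open|exact: cdom_open].
have oU' : open (cimg c' U').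
  by apply: cimg_open; apply: openI; [exact: tdom_open|exact: cdom_open].
pose tau (x : 'rV[R]_m) : 'rV[R]_m := chart c' (cinv c x).
have tauO x : cimg c U x -> cimg c' U' (tau x).
  by move=> /cimgP[[tx c'x] cx _]; exact: cimg_chart.
have tau_smooth l : cinfty (cimg c U) (fun x => tau x 0 l) by exact: transition_cimg.
have xO : cimg c U (chart c p) by exact: cimg_chart.
have tauE : tau (chart c p) = chart c' p by rewrite /tau chartK.
have ct : connection_on (cimg c' U') (local_conn c' t) by apply: local_conn_sub => q [].
have yO : cimg c' U' (chart c' p) by exact: cimg_chart.
have pull i l y : cimg c U y ->
    local_conn c t i l y = epull (jac tau y) (local_conn c' t i l (tau y)).
  move=> /cimgP[[ty c'y] cy Ey].
  have [F _] := nabla_form D (tdom_open t) (@frame_section t i).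
  have [_ /(_ c c' (cinv c y))] := F t l; rewrite setIid.
  move=> /(_ ty cy c'y); rewrite jacobianE Ey /local_conn /tau chartK//.
rewrite /curv linearD /= -tauE.
rewrite (dE_eq oU xO (pull j k)).
rewrite (dE_pull oU oU' tauO tau_smooth (ct.1 j k) (ct.2 j k) xO); congr (_ + _).
rewrite epull_sum; apply: eq_bigr => i _.
rewrite !pull// tauE epull_wedge11//; exact: ct.2.
Qed.

Lemma quantum_curvature_form n : is_endform_on setT (quantum_curvature n).
Proof.
move=> t j k; split=> [c K|c c' p [_ tp] cp c'p].
  have oU : open (tdom t `&` cdom c) by apply: openI; [exact: tdom_open|exact: cdom_open].
  rewrite setTI; apply: (smooth_on_chart (c := c) oU); first by move=> q [].
  have oO := cimg_open (c := c) oU.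
  have ct : connection_on (cimg c (tdom t `&` cdom c)) (local_conn c t).
    by apply: local_conn_sub => q [].
  have sq : smooth_ext (cimg c (tdom t `&` cdom c))
      (fun x => qcurv (wloc w c x) (curv (local_conn c t) j k x) n).
    have sc := smooth_curv oO j k ct.
    case: n => [|[|n]] /=; [exact: sc| |exact: smooth_ext0].
    apply: smooth_extN => //; apply: smooth_iota => //; exact: wloc_smooth.
  apply: (cinfty_eq oO _ (smooth_extE sq K)) => x /cimgP[[tx _] cx Ex] /=.
  rewrite endcomp_quantum_curvature; [|exact: tx|exact: cx].
  by rewrite /curvature_form Ex /wloc.
have E0 := curvature_form_pull j k tp cp c'p.
apply: (etrans (endcomp_quantum_curvature n j k tp cp)).
apply: (etrans _ (congr1 (epull _) (esym (endcomp_quantum_curvature n j k tp c'p)))).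
case: n => [|[|n]] /=; [exact: E0| |by rewrite linear0].
rewrite linearN /= E0 bicontr_epull; last exact: curvature_form_pure.
  by rewrite (bivec_compat w cp c'p).
exact: bivec_antisym.
Qed.

Lemma quantum_curvature_hEndform : is_hEndform quantum_curvature.
Proof.
split; first exact: quantum_curvature_form.
exists 2 => -[|[|n]] c p // _ cp; apply/ffunP => K; rewrite [LHS]ffunE [RHS]ffunE.
by apply: frame_end0 => j k; rewrite ffunE.
Qed.

Lemma quantum_curvature_degree : @hdegree R m M (fun p : M => 'End(E p)%type : vectType R) 2 quantum_curvature.
Proof.
move=> n c p K cp; apply: contra_neqP => Kn; rewrite ffunE.
apply: frame_end0 => j k.
have -> : qcurv (w c p) (curvature_form c (triv_at E p) j k p) n K = 0.
  apply/eqP; apply: contra_notT Kn; apply: qcurv_degree.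
  exact: curvature_form_pure (triv_atP E p) cp.
by [].
Qed.

Lemma qcovd_qcovd Phi : is_hEform Phi ->
  heq (qcovd w D (qcovd w D Phi)) (qwedge_end w Phi quantum_curvature).
Proof.
move=> hPhi n c p cp; set t := triv_at E p; have tp : tdom t p := triv_atP E p.
have bt := frame_basis tp.
apply: (ecomp_inj bt) => k; rewrite qcovd_in_comp//.
rewrite /qwedge_end (ecomp_sum bt).
have Ox := cimg_chart tp cp.
have oO := cimg_open (c := c) (tdom_open t).
have E1 i l y : cimg c (tdom t) y ->
    local_comp c t (qcovd w D Phi) i l y = qDcov c t (local_comp c t Phi) i l y.
  move=> /cimgP[ty cy Ey]; rewrite /local_comp /frame_comp qcovd_comp//.
  by rewrite Ey.
rewrite (qDcov_eq n k Ox E1).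
rewrite qDcov_qDcov; [|by move=> i; exact: local_comp_smooth|exact: Ox].
rewrite (wloc_chart w cp); apply: eq_bigr => j _; congr qwedge; apply/funext => i.
  by rewrite endcomp_quantum_curvature.
by rewrite /local_comp chartK.
Qed.

End Bundle.

Theorem mainTheorem17 (R : realType) (m r : nat) (M : smoothManifold R m)
  (w : poissonStructure M) (E : vectorBundle M r) (nablaE : connection E) :
  exists RhE : hform (fun p : M => 'End(E p)%type),
    is_hEndform RhE /\
    @hdegree R m M (fun p : M => 'End(E p)%type : vectType R) 2 RhE /\
    (forall (k : nat) (Phi : hform (fun p : M => E p)),
       is_hEform Phi -> hdegree k Phi ->
       heq (qcovd w nablaE (qcovd w nablaE Phi)) (qwedge_end w Phi RhE)) /\
    (forall Phi : hform (fun p : M => E p),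
       is_hEform Phi ->
       heq (qcovd w nablaE (qcovd w nablaE Phi)) (qwedge_end w Phi RhE)).
Proof.
exists (quantum_curvature w nablaE); split; first exact: quantum_curvature_hEndform.
split; first exact: quantum_curvature_degree.
by split => [k Phi hPhi _|Phi hPhi]; exact: qcovd_qcovd.
Qed.
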